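(* The only proper normal subgroups of $\Gamma$ with quotient isomorphic to a subgroup of $L_2(q)$ for any prime power $q$ are $\Delta$ and $N_0$, with quotients $\Gamma/\Delta\cong C_2$ and $\Gamma/N_0\cong L_2(11)$.
   Context: $L_2(q)=SL_2(q)/\{\pm I\}$ where $q\geq4$ is a prime power; $C_2$ is the cyclic group of order $2$. $\Gamma=[3,5,3]$ is the Coxeter group $$\langle a,b,c,d\mid a^2=b^2=c^2=d^2=(ab)^3=(bc)^5=(cd)^3=(ac)^2=(ad)^2=(bd)^2=1\rangle,$$ and $\Delta=\Gamma^+=[3,5,3]^+$ is its even subgroup of index $2$ (the kernel of the homomorphism $\Gamma\to C_2$ sending each of $a,b,c,d$ to the generator), with presentation $$\langle\alpha,\beta,\gamma\mid\alpha^3=\beta^5=\gamma^3=(\alpha\beta)^2=(\beta\gamma)^2=(\alpha\beta\gamma)^2=1\rangle,\quad \alpha=ab,\ \beta=bc,\ \gamma=cd.$$ $K_0$ denotes the unique normal subgroup of $\Delta$ with $\Delta/K_0\cong L_2(11)$; it is normal in $\Gamma$ with $\Gamma/K_0\cong L_2(11)\times C_2$. $N_0$ denotes the normal subgroup of $\Gamma$ containing $K_0$ such that $N_0/K_0$ is the direct factor of $\Gamma/K_0\cong L_2(11)\times C_2$ isomorphic to $C_2$. *)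

(* Defs.v *)
From HB Require Import structures.
From mathcomp Require Import all_boot all_order all_algebra all_fingroup.
From mathcomp Require Import boolp classical_sets functions generic_quotient.

Set Implicit Arguments.
Unset Strict Implicit.
Unset Printing Implicit Defensive.

Local Open Scope group_scope.
Local Open Scope quotient_scope.
Local Open Scope classical_set_scope.

Section PresentedGroup.
Variable S : choiceType.

(* The letter [(s, false)] stands for s and [(s, true)] for its inverse. *)
Definition word := seq (S * bool).

Variable R : seq word.

Inductive pres_eq : word -> word -> Prop :=
| pres_eq_refl u : pres_eq u u
| pres_eq_sym u v : pres_eq u v -> pres_eq v u
| pres_eq_trans u v w : pres_eq u v -> pres_eq v w -> pres_eq u w
| pres_eq_cat u u' v v' :
    pres_eq u u' -> pres_eq v v' -> pres_eq (u ++ v) (u' ++ v')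
| pres_eq_cancel s e : pres_eq [:: (s, e); (s, ~~ e)] [::]
| pres_eq_relator r : r \in R -> pres_eq r [::].

Definition pres_eqb (u v : word) : bool := `[< pres_eq u v >].

Fact pres_eqb_equiv : equiv_class_of pres_eqb.
Proof.
split=> [u|u v|v u w].
- by apply/asboolP; exact: pres_eq_refl.
- by apply/asboolP/asboolP; exact: pres_eq_sym.
- by move=> /asboolP uv /asboolP vw; apply/asboolP; exact: pres_eq_trans uv vw.
Qed.

Canonical pres_equiv := EquivRelPack pres_eqb_equiv.

(* The group with presentation < S | r = 1 for r in R >. *)
Definition presented := {eq_quot pres_equiv}.

HB.instance Definition _ := Choice.on presented.
HB.instance Definition _ := Quotient.on presented.

Definition pres_class (u : word) : presented := \pi_presented u.

Lemma pres_classP u v : pres_class u = pres_class v <-> pres_eq u v.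
Proof.
by split=> [/eqmodP /asboolP|uv] //; apply/eqmodP/asboolP.
Qed.

Lemma pres_reprK (x : presented) : pres_class (repr x) = x.
Proof. exact: reprK. Qed.

Lemma repr_pres_class u : pres_eq (repr (pres_class u)) u.
Proof. by apply/pres_classP; rewrite pres_reprK. Qed.

Definition winv (u : word) : word := rev [seq (l.1, ~~ l.2) | l <- u].

Lemma winv_cat u v : winv (u ++ v) = winv v ++ winv u.
Proof. by rewrite /winv map_cat rev_cat. Qed.

Lemma winvK : involutive winv.
Proof.
move=> u; rewrite /winv map_rev revK -map_comp -[RHS]map_id.
by apply: eq_map => -[s e] /=; rewrite negbK.
Qed.

Lemma pres_eq_winvr u : pres_eq (u ++ winv u) [::].
Proof.
elim: u => [|[s e] u IHu]; first exact: pres_eq_refl.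
rewrite -cat1s winv_cat -catA (catA u).
apply: (pres_eq_trans _ (pres_eq_cancel s e)).
rewrite -[[:: (s, e); (s, ~~ e)]]/([:: (s, e)] ++ ([::] ++ [:: (s, ~~ e)])).
apply: pres_eq_cat; first exact: pres_eq_refl.
by apply: pres_eq_cat; [exact: IHu | exact: pres_eq_refl].
Qed.

Lemma pres_eq_winvl u : pres_eq (winv u ++ u) [::].
Proof. by rewrite -{2}(winvK u); exact: pres_eq_winvr. Qed.

Lemma pres_eq_winv u v : pres_eq u v -> pres_eq (winv u) (winv v).
Proof.
move=> uv; rewrite -[winv u]cats0 -[winv v]cat0s.
apply: (@pres_eq_trans _ (winv u ++ (v ++ winv v))).
  by apply: pres_eq_cat; [exact: pres_eq_refl|exact/pres_eq_sym/pres_eq_winvr].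
rewrite catA; apply: pres_eq_cat; last exact: pres_eq_refl.
apply: pres_eq_trans (pres_eq_winvl u).
by apply: pres_eq_cat; [exact: pres_eq_refl|exact: pres_eq_sym].
Qed.

Definition pres_mul (x y : presented) : presented :=
  pres_class (repr x ++ repr y).
Definition pres_inv (x : presented) : presented := pres_class (winv (repr x)).
Definition pres_one : presented := pres_class [::].

Lemma pres_mulE u v :
  pres_mul (pres_class u) (pres_class v) = pres_class (u ++ v).
Proof. by apply/pres_classP/pres_eq_cat; exact: repr_pres_class. Qed.

Lemma pres_invE u : pres_inv (pres_class u) = pres_class (winv u).
Proof. by apply/pres_classP/pres_eq_winv; exact: repr_pres_class. Qed.

Fact pres_mulA : associative pres_mul.
Proof.
move=> x y z; rewrite -(pres_reprK x) -(pres_reprK y) -(pres_reprK z).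
by rewrite !pres_mulE catA.
Qed.

Fact pres_mul1 : left_id pres_one pres_mul.
Proof. by move=> x; rewrite -(pres_reprK x) pres_mulE. Qed.

Fact pres_mulr1 : right_id pres_one pres_mul.
Proof. by move=> x; rewrite -(pres_reprK x) pres_mulE cats0. Qed.

Fact pres_mulV : left_inverse pres_one pres_inv pres_mul.
Proof.
move=> x; rewrite -(pres_reprK x) pres_invE pres_mulE.
exact/pres_classP/pres_eq_winvl.
Qed.

Fact pres_mulrV : right_inverse pres_one pres_inv pres_mul.
Proof.
move=> x; rewrite -(pres_reprK x) pres_invE pres_mulE.
exact/pres_classP/pres_eq_winvr.
Qed.

HB.instance Definition _ :=
  isGroup.Build presented pres_mulA pres_mul1 pres_mulr1 pres_mulV pres_mulrV.

Definition pres_gen (s : S) : presented := pres_class [:: (s, false)].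

Section Lift.
Variables (H : groupType) (f : S -> H).

Definition word_eval (u : word) : H :=
  \prod_(l <- u) (if l.2 then (f l.1)^-1 else f l.1).

(* The homomorphism extending f, when f respects the relators. *)
Definition pres_lift (x : presented) : H := word_eval (repr x).

Hypothesis f_rel : forall r, r \in R -> word_eval r = 1.

Lemma word_eval_pres_eq u v : pres_eq u v -> word_eval u = word_eval v.
Proof.
elim=> {u v} // [u v w _ -> _ -> //|u u' v v' _ uu' _ vv'|s e|r /f_rel ->].
- by rewrite /word_eval !big_cat /= -!/(word_eval _) uu' vv'.
- by rewrite /word_eval !big_cons big_nil mulg1; case: e; rewrite ?mulVg ?mulgV.
- by rewrite /word_eval big_nil.
Qed.

Lemma pres_liftE u : pres_lift (pres_class u) = word_eval u.
Proof. exact/word_eval_pres_eq/repr_pres_class. Qed.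

Lemma pres_lift_gen s : pres_lift (pres_gen s) = f s.
Proof. by rewrite pres_liftE /word_eval big_seq1. Qed.

Lemma pres_liftM : {morph pres_lift : x y / x * y}.
Proof.
move=> x y; rewrite -(pres_reprK x) -(pres_reprK y) [_ * _]pres_mulE !pres_liftE.
by rewrite /word_eval big_cat.
Qed.

End Lift.
End PresentedGroup.

Section Quotients.
Variable G : groupType.
Implicit Types H K N : set G.

Definition subgroup H := H 1 /\ forall x y, H x -> H y -> H (x * y^-1).

Definition normal_in N H :=
  [/\ subgroup N, subgroup H, N `<=` H & forall x h, N x -> H h -> N (x ^ h)].

Definition set_mul (A B : set G) : set G := [set x * y | x in A & y in B].

Definition coset_set N H : set (set G) := [set set_mul [set h] N | h in H].

(* f is an isomorphism from H / N, i.e. the cosets hN (h in H) with setwise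
   multiplication, onto A. *)
Definition quot_iso H N (aT : finGroupType) (A : {set aT}) (f : set G -> aT) :=
  set_bij (coset_set N H) [set` A] f /\
  forall X Y, coset_set N H X -> coset_set N H Y ->
    f (set_mul X Y) = f X * f Y.

Definition quot_isog H N (aT : finGroupType) (A : {set aT}) :=
  exists f : set G -> aT, quot_iso H N A f.

End Quotients.

Section L2.
Variable F : finFieldType.

Definition SL2 : {set {'GL_2[F]}} := [set u | \det (GLval u) == 1]%R%SET.

Fact SL2_group_set : group_set SL2.
Proof.
apply/group_setP; split=> [|u v]; rewrite !inE ?GL_1E ?det1 //.
by rewrite GL_ME det_mulmx => /eqP-> /eqP->; rewrite GRing.mulr1.
Qed.
Canonical SL2_group := Group SL2_group_set.

Definition pmI : {set {'GL_2[F]}} :=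
  [set u | (GLval u == 1) || (GLval u == -1)]%R%SET.

Fact pmI_group_set : group_set pmI.
Proof.
apply/group_setP; split=> [|u v]; rewrite !inE ?GL_1E ?eqxx //.
rewrite GL_ME => /orP[]/eqP-> /orP[]/eqP->;
  by rewrite ?GRing.mulr1 ?GRing.mul1r ?GRing.mulrNN ?GRing.mulr1 eqxx ?orbT.
Qed.
Canonical pmI_group := Group pmI_group_set.

Definition L2 : {set coset_of pmI} := SL2 / pmI.

End L2.

Definition C2 : {set 'Z_2} := [set: 'Z_2]%SET.

Definition gen_a : 'I_4 := @Ordinal 4 0 isT.
Definition gen_b : 'I_4 := @Ordinal 4 1 isT.
Definition gen_c : 'I_4 := @Ordinal 4 2 isT.
Definition gen_d : 'I_4 := @Ordinal 4 3 isT.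

Definition wpow (s : seq 'I_4) (n : nat) : word 'I_4 :=
  flatten (nseq n [seq (i, false) | i <- s]).

Definition coxeter353_relators : seq (word 'I_4) :=
  [:: wpow [:: gen_a] 2; wpow [:: gen_b] 2; wpow [:: gen_c] 2;
      wpow [:: gen_d] 2;
      wpow [:: gen_a; gen_b] 3; wpow [:: gen_b; gen_c] 5;
      wpow [:: gen_c; gen_d] 3; wpow [:: gen_a; gen_c] 2;
      wpow [:: gen_a; gen_d] 2; wpow [:: gen_b; gen_d] 2].

Definition Gamma : groupType := presented coxeter353_relators.

(* The group law of 'Z_2 is addition, so the ring element 1 is the generator. *)
Definition parity : Gamma -> 'Z_2 := pres_lift (fun=> 1%R : 'Z_2).

Lemma parity_relators r :
  r \in coxeter353_relators -> word_eval (fun=> 1%R : 'Z_2) r = 1.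
Proof.
rewrite !inE; do ![case/orP]; move/eqP=> ->; apply/eqP;
  by rewrite /word_eval unlock.
Qed.

Lemma parityM : {morph parity : x y / x * y}.
Proof. exact: pres_liftM parity_relators. Qed.

HB.instance Definition _ := isMultiplicative.Build Gamma 'Z_2 parity parityM.

Lemma parity_gen s : parity (pres_gen _ s) = 1%R.
Proof. exact: pres_lift_gen parity_relators s. Qed.

Definition Delta : set Gamma := [set x | parity x = 1].

Definition is_K0 (K : set Gamma) :=
  normal_in K Delta /\ quot_isog Delta K (L2 'F_11).

(* N / K is the factor C_2 of Gamma / K, for some isomorphism of Gamma / K with
   L_2(11) x C_2. *)
Definition is_N0 (K N : set Gamma) :=
  [/\ normal_in K setT, normal_in N setT, K `<=` N &
      exists f : set Gamma -> coset_of (pmI 'F_11) * 'Z_2,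
        quot_iso setT K (finset.setX (L2 'F_11) C2) f /\
        f @` coset_set K N = [set` finset.setX [1 coset_of (pmI 'F_11)] C2]].

(* Finite fields are taken up to isomorphism, so F ranges over the fields with
   q elements, for the prime powers q >= 4. *)
Definition quot_in_some_L2 (N : set Gamma) :=
  exists (F : finFieldType) (H : {group coset_of (pmI F)}),
    [/\ (4 <= #|F|)%N, H \subset L2 F & quot_isog setT N H].

(* Main.v *)
Require Import Defs.
From HB Require Import structures.
From mathcomp Require Import all_boot all_order all_algebra all_fingroup.
From mathcomp Require Import boolp classical_sets functions.
From mathcomp Require Import ring.

(** Nontrivial involutions of L_2(F), in odd characteristic, are the classes of
the traceless matrices X of determinant 1, which satisfy X^2 = -1.  On the
three-dimensional space of traceless matrices the form -tr(XY) is nondegenerate,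
and conjugation by such an X is minus the reflection in X:
X Y X^-1 = -Y - tr(XY) X.  So, for involutions spanning that space, the matrix
by which a word in them acts by conjugation depends only on the Gram matrix;
as a word is trivial in L_2(F) when it acts trivially, the Gram matrix
determines which words are trivial ([word_pm1]).

A homomorphism from Gamma to L_2(F) that does not identify a and b is given by
four involutions.  The Coxeter relations constrain the traces of products of
their lifts: tr = 0 for the commuting pairs, tr^2 = 1 for products of order 3,
and s^4 - 3 s^2 + 1 = 0 for the trace s of bc.  Four vectors in dimension 3
have a singular Gram matrix, so 9 - 4 s^2 = 0; with the quartic this forces
11 = 0 and s^2 = 16 ([four_traces]).  Up to signs of the lifts the Gram matrix
is unique, so all these homomorphisms have the same kernel, for all F
([four_involutions_word]).  In characteristic 2, a commutes with c and d,
centralizers of nonscalar matrices are commutative, and so c and d commute,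
which makes c = d.  If two neighbouring generators are identified, all four are
([coxeter_collapse]), and the kernel is Delta or Gamma.  One explicit
homomorphism phi onto L_2(11) then supplies the remaining kernel N_0
([Gamma_kernel_cases]).

Delta is generated by the involutions P = ad, Q = ac, R = bd, where PQ and PR
have order 3 and RPQ = bc has order 5.  The orders of PQ and PR determine, up to
signs, the Gram matrix of three lifts except for its entry r at Q and R.  As
tr(PQR)^2 is a quadratic polynomial in r, the order of RPQ gives a quartic
equation for r, whose only root in F_11 is 6.  So every nontrivial homomorphism from Delta to
L_2(11) has the same kernel ([Delta_kernel]), which gives the uniqueness
of K_0; K_0 itself is the kernel of phi on Delta, which is onto since two words
of even length go to the two elementary transvections ([phi_onto]).

If N / K_0 is the factor C_2 for some isomorphism from Gamma / K_0 to
L_2(11) x C_2, then N is the kernel of a homomorphism from Gamma onto L_2(11),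
and the classification of these kernels gives N = N_0 ([is_N0_unique]). *)

Set Implicit Arguments.
Unset Strict Implicit.
Unset Printing Implicit Defensive.

(** * Two-by-two matrices of determinant one *)
Section TwoByTwo.
Import GRing.Theory.
Local Open Scope ring_scope.
Variable F : fieldType.
Implicit Types (a b c d x y z : F) (M N X Y Z : 'M[F]_2).

(** Explicit entries turn identities between matrices into polynomial ones. *)
Definition mx2 a b c d : 'M[F]_2 :=
  \matrix_(i, j) if i == 0 then (if j == 0 then a else b)
                 else (if j == 0 then c else d).

Lemma mx2P M : exists a b c d, M = mx2 a b c d.
Proof.
exists (M 0 0), (M 0 1), (M 1 0), (M 1 1); apply/matrixP=> i j; rewrite mxE.
by case: i j => [[|[|i]] ?] [[|[|j]] ?] //=; congr (M _ _); apply: val_inj.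
Qed.

Lemma mx2_eqP a b c d a' b' c' d' :
  mx2 a b c d = mx2 a' b' c' d' <-> [/\ a = a', b = b', c = c' & d = d'].
Proof.
split=> [/matrixP e|[-> -> -> ->]//].
by have:= e 0 0; have:= e 0 1; have:= e 1 0; have:= e 1 1; rewrite !mxE.
Qed.

Lemma mx2M a b c d a' b' c' d' : mx2 a b c d * mx2 a' b' c' d' =
  mx2 (a * a' + b * c') (a * b' + b * d') (c * a' + d * c') (c * b' + d * d').
Proof.
by apply/matrixP=> i j; rewrite !mxE 2!big_ord_recl big_ord0 !mxE /= addr0;
   case: ifP; case: ifP.
Qed.

Lemma mx2D a b c d a' b' c' d' :
  mx2 a b c d + mx2 a' b' c' d' = mx2 (a + a') (b + b') (c + c') (d + d').
Proof. by apply/matrixP=> i j; rewrite !mxE; case: ifP; case: ifP. Qed.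

Lemma mx2N a b c d : - mx2 a b c d = mx2 (- a) (- b) (- c) (- d).
Proof. by apply/matrixP=> i j; rewrite !mxE; case: ifP; case: ifP. Qed.

Lemma mx2Z x a b c d : x *: mx2 a b c d = mx2 (x * a) (x * b) (x * c) (x * d).
Proof. by apply/matrixP=> i j; rewrite !mxE; case: ifP; case: ifP. Qed.

Lemma mx2_1 : 1 = mx2 1 0 0 1.
Proof.
by apply/matrixP=> i j; rewrite !mxE; case: i j => [[|[|i]] ?] [[|[|j]] ?].
Qed.

Lemma mx2_0 : 0 = mx2 0 0 0 0.
Proof. by apply/matrixP=> i j; rewrite !mxE; case: ifP; case: ifP. Qed.

Lemma mx2_tr a b c d : \tr (mx2 a b c d) = a + d.
Proof. by rewrite /mxtrace 2!big_ord_recl big_ord0 !mxE /= addr0. Qed.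

Lemma mx2_det a b c d : \det (mx2 a b c d) = a * d - b * c.
Proof.
rewrite (expand_det_row _ 0) 2!big_ord_recl big_ord0 /cofactor !det_mx11 !mxE /=.
by rewrite addr0 mul1r expr1 mulN1r mulrN.
Qed.

Definition mx2E := (mx2M, mx2D, mx2N, mx2Z, mx2_tr, mx2_det).

Lemma det_prod2 M N : \det M = 1 -> \det N = 1 -> \det (M * N) = 1.
Proof. by move=> dM dN; rewrite det_mulmx dM dN mulr1. Qed.

Lemma det_pow M n : \det M = 1 -> \det (M ^+ n) = 1.
Proof.
move=> dM; elim: n => [|n IHn]; first by rewrite det1.
by rewrite exprS det_prod2.
Qed.

Definition pm1 M := M = 1 \/ M = - 1.

Lemma sqr_det1 M : \det M = 1 -> M * M = \tr M *: M - 1.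
Proof.
have [a [b [c [d ->]]]] := mx2P M.
rewrite mx2_1 !mx2E => e; apply/mx2_eqP; split; try (by ring).
  by rewrite -e; ring.
by rewrite -e; ring.
Qed.

(** A scalar matrix of determinant 1 is 1 or -1. *)
Lemma det1_free M x y :
  \det M = 1 -> ~ pm1 M -> x *: M = y *: 1 -> x = 0 /\ y = 0.
Proof.
move=> dM nM exy; have [x0|nx0] := eqVneq x 0.
  split=> //; move: exy; rewrite x0 scale0r => /esym/eqP.
  by rewrite scaler_eq0 oner_eq0 orbF => /eqP.
have eM : M = (y / x) *: 1.
  by rewrite mulrC -scalerA -exy scalerA mulVf // scale1r.
case: nM; move: dM; rewrite eM; set z := y / x.
rewrite [in \det _]mx2_1 !mx2E !mulr0 !mulr1 subr0 -expr2 => /eqP.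
by rewrite -subr_eq0 subr_sqr_1 mulf_eq0 subr_eq0 addr_eq0 /pm1 =>
  /orP[]/eqP->; rewrite ?scaleN1r ?scale1r; auto.
Qed.

Lemma det1_lin_pm1 M x y :
  \det M = 1 -> ~ pm1 M -> pm1 (x *: M + y *: 1) -> x = 0.
Proof.
move=> dM nM pmM; suff [z] : exists z, x *: M = z *: 1.
  by move=> /(det1_free dM nM)[].
case: pmM => /(canRL (addrK _)) ->; [exists (1 - y)|exists (- 1 - y)].
  by rewrite scalerBl scale1r.
by rewrite scalerBl scaleN1r.
Qed.

(** The Cayley-Hamilton theorem as a recursion on powers: in the basis M, 1 the
coefficient of M in M^n is a polynomial in the trace, and it has to vanish
when M^n is 1 or -1. *)
Lemma exp_det1 M x y : \det M = 1 -> let t := \tr M in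
  M * (x *: M + y *: 1) = (x * t + y) *: M + (- x) *: 1.
Proof.
move=> dM /=; rewrite mulrDr -!scalerAr mulr1 (sqr_det1 dM) scalerBr scalerA.
by rewrite scalerDl scaleNr addrAC.
Qed.

Section Traces.
Variable M : 'M[F]_2.
Hypotheses (dM : \det M = 1) (nM : ~ pm1 M).
Let t := \tr M.

Let M1 : M = 1 *: M + 0 *: 1. Proof. by rewrite scale1r scale0r addr0. Qed.

Lemma trace_order2 : pm1 (M ^+ 2) -> t = 0.
Proof.
rewrite expr2 [in X in M * X]M1 exp_det1 // => /det1_lin_pm1 <- //.
by rewrite -/t; ring.
Qed.

Lemma trace_order3 : pm1 (M ^+ 3) -> t ^+ 2 = 1.
Proof.
rewrite !exprS expr0 mulr1 {3}M1 !exp_det1 // => /det1_lin_pm1 e.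
by apply/subr0_eq; rewrite -e // -/t; ring.
Qed.

Lemma trace_order5 : pm1 (M ^+ 5) -> t ^+ 4 - t ^+ 2 *+ 3 + 1 = 0.
Proof.
rewrite !exprS expr0 mulr1 {5}M1 !exp_det1 // => /det1_lin_pm1 <- //.
by rewrite -/t; ring.
Qed.
End Traces.

Lemma comm_sym_tr X Y : \tr X = 0 -> \tr Y = 0 -> X * Y + Y * X = \tr (X * Y) *: 1.
Proof.
have [a [b [c [d ->]]]] := mx2P X; have [a' [b' [c' [d' ->]]]] := mx2P Y.
rewrite mx2_1 !mx2E => /(canRL (addKr _)) -> /(canRL (addKr _)) ->.
by apply/mx2_eqP; split; ring.
Qed.

Lemma commute_nonscalar X Y : (forall x, X <> x *: 1) -> X * Y = Y * X ->
  exists x y, Y = x *: X + y *: 1.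
Proof.
have [a [b [c [d ->]]]] := mx2P X; have [a' [b' [c' [d' ->]]]] := mx2P Y.
rewrite !mx2E mx2_1 => nX /mx2_eqP[/eqP]; rewrite -subr_eq0 => /eqP e1.
move=> /eqP; rewrite -subr_eq0 => /eqP e2.
move=> /eqP; rewrite -subr_eq0 => /eqP e3 _.
have [b0|nb] := eqVneq b 0; last first.
  exists (b' / b), (a' - b' / b * a); rewrite !mx2E; apply/mx2_eqP.
  split; apply/subr0_eq; try (by field).
    by rewrite -[RHS](mul0r b^-1) -[in RHS]e1; field.
  by rewrite -[RHS](mul0r b^-1) -[in RHS]e2; field.
have [c0|nc] := eqVneq c 0; last first.
  exists (c' / c), (a' - c' / c * a); rewrite !mx2E; apply/mx2_eqP.
  split; apply/subr0_eq; try (by field).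
    by rewrite -[RHS](mul0r (- c^-1)) -[in RHS]e1; field.
  by rewrite -[RHS](mul0r (- c^-1)) -[in RHS]e3; field.
have nD : a - d != 0.
  apply/eqP=> /subr0_eq ad; apply: (nX a).
  by rewrite mx2E b0 c0 -ad !mulr0 !mulr1.
exists ((a' - d') / (a - d)), (a' - (a' - d') / (a - d) * a).
rewrite !mx2E; apply/mx2_eqP; split; apply/subr0_eq; try (by field).
  by rewrite -[RHS](mul0r (a - d)^-1) -[in RHS]e2; field.
by rewrite -[RHS](mul0r (- (a - d)^-1)) -[in RHS]e3; field.
Qed.

(** Cramer's rule: on traceless matrices tr(X Y Z) is an alternating trilinear
form, so X, Y, Z form a basis as soon as it does not vanish. *)
Lemma tracefree_span X Y Z T :
  \tr X = 0 -> \tr Y = 0 -> \tr Z = 0 -> \tr T = 0 ->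
  \tr (X * Y * Z) *: T =
    \tr (T * Y * Z) *: X + \tr (X * T * Z) *: Y + \tr (X * Y * T) *: Z.
Proof.
have [a [b [c [d ->]]]] := mx2P X; have [a' [b' [c' [d' ->]]]] := mx2P Y.
have [e [f [g [h ->]]]] := mx2P Z; have [e' [f' [g' [h' ->]]]] := mx2P T.
rewrite !mx2E; do 4!move=> /(canRL (addKr _)) ->.
by apply/mx2_eqP; split; ring.
Qed.

(** The square of a volume form is a multiple of the Gram determinant. *)
Lemma gram_det3 X Y Z : \tr X = 0 -> \tr Y = 0 -> \tr Z = 0 ->
  let x := \tr (X * X) in let y := \tr (Y * Y) in let z := \tr (Z * Z) in
  let u := \tr (Y * Z) in let v := \tr (X * Z) in let w := \tr (X * Y) in
  - (\tr (X * Y * Z) ^+ 2 *+ 2) =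
  x * y * z + u * v * w *+ 2 - x * u ^+ 2 - y * v ^+ 2 - z * w ^+ 2.
Proof.
have [a [b [c [d ->]]]] := mx2P X; have [a' [b' [c' [d' ->]]]] := mx2P Y.
have [e [f [g [h ->]]]] := mx2P Z.
rewrite !mx2E; do 3!move=> /(canRL (addKr _)) ->.
by move=> /=; ring.
Qed.

(** The left-hand side is the determinant of the 4 x 4 Gram matrix, which vanishes
because traceless matrices have dimension 3. *)
Lemma gram_det4 X Y Z T :
  \tr X = 0 -> \tr Y = 0 -> \tr Z = 0 -> \tr T = 0 ->
  let x := \tr (X * X) in let y := \tr (Y * Y) in
  let z := \tr (Z * Z) in let t := \tr (T * T) in
  let u := \tr (X * Y) in let p := \tr (X * Z) in let q := \tr (X * T) in
  let v := \tr (Y * Z) in let r := \tr (Y * T) in let w := \tr (Z * T) in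
  x * y * z * t - x * y * w ^+ 2 - x * z * r ^+ 2 - x * t * v ^+ 2
  - y * z * q ^+ 2 - y * t * p ^+ 2 - z * t * u ^+ 2
  + (x * v * r * w + y * p * q * w + z * u * q * r + t * u * p * v
     - u * w * p * r - u * w * q * v - p * r * q * v) *+ 2
  + u ^+ 2 * w ^+ 2 + p ^+ 2 * r ^+ 2 + q ^+ 2 * v ^+ 2 = 0.
Proof.
have [a [b [c [d ->]]]] := mx2P X; have [a' [b' [c' [d' ->]]]] := mx2P Y.
have [e [f [g [h ->]]]] := mx2P Z; have [e' [f' [g' [h' ->]]]] := mx2P T.
rewrite !mx2E; do 4!move=> /(canRL (addKr _)) ->.
by move=> /=; ring.
Qed.

Lemma tracefree_pairing_eq0 Z :
  2%:R != 0 :> F -> \tr Z = 0 -> (forall Y, \tr Y = 0 -> \tr (Z * Y) = 0) -> Z = 0.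
Proof.
have [a [b [c [d ->]]]] := mx2P Z; rewrite mx2E => n2 ad Z0.
have := Z0 (mx2 0 1 0 0); have := Z0 (mx2 0 0 1 0); have := Z0 (mx2 1 0 0 (-1)).
rewrite !mx2E !mulr0 !mulr1 !addr0 !add0r subrr mulrN1 => /(_ erefl) ad'.
move=> /(_ erefl) -> /(_ erefl) ->; rewrite mx2_0.
have a0 : a = 0.
  apply/(mulfI n2); rewrite mulr0 -[RHS]addr0 -{1}ad -ad'; ring.
by move: ad; rewrite a0 add0r => ->.
Qed.

Lemma comm_tracefree_pm1 M :
  \det M = 1 -> (forall Y, \tr Y = 0 -> M * Y = Y * M) -> pm1 M.
Proof.
move=> dM cM; apply: contrapT => nM.
suff [x eM] : exists x, 1 *: M = x *: 1.
  by have [/eqP] := det1_free dM nM eM; rewrite oner_eq0.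
have := cM (mx2 0 1 0 0); have := cM (mx2 0 0 1 0); rewrite scale1r.
have [a [b [c [d ->]]]] := mx2P M; rewrite !mx2E !mulr0 !mul0r !mulr1 !mul1r.
rewrite !addr0 !add0r => /(_ erefl)/mx2_eqP[b0 _ _ _].
move=> /(_ erefl)/mx2_eqP[c0 ad _ _]; rewrite b0 -c0 -ad.
by exists a; rewrite mx2_1 mx2E mulr0 mulr1.
Qed.

End TwoByTwo.

(** * Words in traceless matrices, up to sign, from the Gram matrix *)
Section Gram.
Import GRing.Theory.
Local Open Scope ring_scope.

(** The integers n_j with W X_k W^-1 = sum of n_j X_j, where W is the product of
the X_i over the word w and g i j = -tr(X_i X_j).  They are computed from g
alone, so they serve for all fields at once; they need not be unique. *)
Fixpoint conj_coef n (g : 'I_n -> 'I_n -> int) (w : seq 'I_n) (k j : 'I_n) : int :=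
  if w is i :: w' then
    - conj_coef g w' k j + (j == i)%:R * \sum_l conj_coef g w' k l * g i l
  else (j == k)%:R.

(** The pairing of W X_k W^-1 - X_k with X_l. *)
Definition gram_defect n g (w : seq 'I_n) (k l : 'I_n) : int :=
  \sum_j conj_coef g w k j * g j l - g k l.

Variables (F : fieldType) (n : nat) (g : 'I_n -> 'I_n -> int).
Variable X : 'I_n -> 'M[F]_2.
Hypotheses (trX : forall i, \tr (X i) = 0) (detX : forall i, \det (X i) = 1).
Hypothesis gramX : forall i j, \tr (X i * X j) = - (g i j)%:~R.
Hypothesis spanX : forall Z, \tr Z = 0 -> exists c, Z = \sum_i c i *: X i.

Let W (w : seq 'I_n) := \prod_(i <- w) X i.

Lemma sqr_tracefree i : X i * X i = - 1.
Proof. by rewrite sqr_det1 // trX scale0r add0r. Qed.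

(** Conjugation by X_i is minus the reflection in X_i. *)
Lemma conj_letter i j : X i * X j = (- X j + (g i j)%:~R *: X i) * X i.
Proof.
rewrite mulrDl mulNr -scalerAl sqr_tracefree -(opprK (g i j)%:~R) -gramX.
by rewrite scaleNr scalerN opprK -(comm_sym_tr (trX i) (trX j)) addrC addrK.
Qed.

Lemma conj_word w k :
  W w * X k = (\sum_j (conj_coef g w k j)%:~R *: X j) * W w.
Proof.
rewrite /W; elim: w => [|i w IHw] /=.
  rewrite big_nil mul1r mulr1 (bigD1 k) //= eqxx scale1r big1 ?addr0 //.
  by move=> j /negPf->; rewrite scale0r.
rewrite big_cons -mulrA IHw !mulrA; congr (_ * _).
rewrite mulr_sumr.
rewrite (eq_bigr (fun j => ((conj_coef g w k j)%:~R *: (- X j)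
    + (conj_coef g w k j * g i j)%:~R *: X i) * X i)); last first.
  by move=> j _; rewrite -scalerAr conj_letter scalerAl scalerDr intrM scalerA.
rewrite -mulr_suml; congr (_ * _); rewrite big_split -scaler_suml.
rewrite [RHS](eq_bigr (fun j => (conj_coef g w k j)%:~R *: (- X j)
    + ((j == i)%:R * \sum_l conj_coef g w k l * g i l)%:~R *: X j)); last first.
  by move=> j _; rewrite intrD scalerDl mulrNz scaleNr scalerN.
rewrite big_split [X in _ = _ + X](bigD1 i) //= eqxx mul1r rmorph_sum /=.
rewrite [X in _ = _ + (_ + X)]big1 ?addr0 // => j /negPf->.
by rewrite mul0r scale0r.
Qed.

Lemma det_word w : \det (W w) = 1.
Proof.
rewrite /W; elim: w => [|i w IHw]; first by rewrite big_nil det1.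
by rewrite big_cons det_mulmx detX IHw mulr1.
Qed.

Lemma trace_combination (c : 'I_n -> F) l :
  \tr ((\sum_j c j *: X j) * X l) = - \sum_j c j * (g j l)%:~R.
Proof.
rewrite mulr_suml raddf_sum -sumrN; apply: eq_bigr => j _.
by rewrite -scalerAl /= mxtraceZ gramX mulrN.
Qed.

Lemma intr_gram_defect w k l :
  (gram_defect g w k l)%:~R =
  \tr (X k * X l) - \tr ((\sum_j (conj_coef g w k j)%:~R *: X j) * X l) :> F.
Proof.
rewrite trace_combination gramX opprK addrC /gram_defect intrB rmorph_sum /=.
by congr (_ - _); apply: eq_bigr => j _; rewrite -intrM.
Qed.

(** W is 1 or -1 when it commutes with a spanning family of traceless matrices.
Pairing with the X_l detects this, the form being nondegenerate; the result is
a condition on g that does not mention X. *)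
Lemma word_pm1 w : 2%:R != 0 :> F ->
  pm1 (W w) <-> forall k l, (gram_defect g w k l)%:~R = 0 :> F.
Proof.
move=> n2; split=> [pmW k l|gr0].
  rewrite intr_gram_defect; suff -> : \sum_j (conj_coef g w k j)%:~R *: X j = X k.
    by rewrite subrr.
  have := conj_word w k; case: pmW => ->; first by rewrite mul1r mulr1.
  by rewrite mulN1r mulrN1 => /oppr_inj.
apply: comm_tracefree_pm1 (det_word w) _ => _ /spanX[c ->].
rewrite mulr_sumr mulr_suml; apply: eq_bigr => k _.
rewrite -scalerAr -scalerAl; congr (_ *: _); rewrite conj_word; congr (_ * _).
apply/subr0_eq/tracefree_pairing_eq0 => // [|_ /spanX[d ->]].
  rewrite raddfB /= trX subr0 raddf_sum big1 // => j _.
  by rewrite /= mxtraceZ trX mulr0.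
rewrite mulr_sumr raddf_sum big1 // => l _.
rewrite -scalerAr /= mxtraceZ mulrBl raddfB -opprB -intr_gram_defect gr0.
by rewrite oppr0 mulr0.
Qed.

End Gram.

(** * The projection from SL_2(F) to L_2(F) *)
Section Projection.
Local Open Scope ring_scope.
Variable F : finFieldType.
Implicit Types M N : 'M[F]_2.

(** The value is meaningful for determinant 1 only; a total function avoids
carrying proofs of invertibility through matrix computations. *)
Definition psl M : coset_of (pmI F) := coset (pmI F) (insubd (1%g : {'GL_2[F]}) M).

Lemma GLval_insubd M : \det M = 1 -> GLval (insubd (1%g : {'GL_2[F]}) M) = M.
Proof.
move=> dM; apply: insubdK.
by rewrite -[_ \in _]/(M \in unitmx) unitmxE dM GRing.unitr1.
Qed.

Lemma norm_pmI (u : {'GL_2[F]}) : u \in 'N(pmI F)%g.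
Proof.
apply/(fintype.subsetP (cent_sub _))/centP=> v; rewrite inE => vpm.
apply: (val_inj : injective (@GLval 2 F)); rewrite !GL_ME; case/orP: vpm => /eqP->.
  by rewrite GRing.mulr1 GRing.mul1r.
by rewrite GRing.mulrN1 GRing.mulN1r.
Qed.

Lemma pslM M N : \det M = 1 -> \det N = 1 -> psl (M * N) = (psl M * psl N)%g.
Proof.
move=> dM dN; rewrite /psl -coset_morphM ?norm_pmI //; congr coset.
apply: (val_inj : injective (@GLval 2 F)).
by rewrite GL_ME !GLval_insubd // det_mulmx dM dN GRing.mulr1.
Qed.

Lemma psl_eq1 M : \det M = 1 -> psl M = 1%g <-> pm1 M.
Proof.
move=> dM; have inpm :
    (insubd (1%g : {'GL_2[F]}) M \in pmI F) = ((M == 1) || (M == -1)).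
  by rewrite inE GLval_insubd.
split=> [/coset_idr|pM].
  by rewrite inpm => /(_ (norm_pmI _))/orP[]/eqP; [left|right].
by apply: coset_id; rewrite inpm; case: pM => ->; rewrite eqxx ?orbT.
Qed.

Lemma psl1 : psl 1 = 1%g.
Proof. by apply/psl_eq1; [rewrite det1|left]. Qed.

Lemma psl_in M : \det M = 1 -> psl M \in L2 F.
Proof.
by move=> dM; rewrite mem_quotient // inE GLval_insubd // dM.
Qed.

Lemma psl_surj x : x \in L2 F -> exists M, \det M = 1 /\ x = psl M.
Proof.
case/morphimP=> u _; rewrite inE => /eqP du ->; exists (GLval u); split=> //.
by congr coset; apply: (val_inj : injective (@GLval 2 F)); rewrite GLval_insubd.
Qed.

Lemma psl_word (I : Type) (X : I -> 'M[F]_2) (w : seq I) :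
  (forall i, \det (X i) = 1) ->
  psl (\prod_(i <- w) X i) = (\prod_(i <- w) psl (X i))%g /\
  \det (\prod_(i <- w) X i) = 1.
Proof.
move=> dX; elim: w => [|i w [IH1 IH2]]; first by rewrite !big_nil psl1 det1.
by rewrite !big_cons pslM // det_mulmx dX IH1 IH2 GRing.mulr1.
Qed.

Lemma pslX M n : \det M = 1 -> psl (M ^+ n) = (psl M ^+ n)%g.
Proof.
move=> dM; elim: n => [|n IHn]; first by rewrite psl1.
by rewrite GRing.exprS expgS pslM ?det_pow // IHn.
Qed.

Lemma pslN M : \det M = 1 -> psl (- M) = psl M.
Proof.
move=> dM; have dN1 : (\det (- 1 : 'M[F]_2) = 1).
  by rewrite mx2_1 !mx2E; ring.
rewrite -GRing.mulN1r pslM // (_ : psl _ = 1%g) ?mul1g //.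
by apply/psl_eq1; last right.
Qed.

Lemma psl_eq M N : \det M = 1 -> \det N = 1 -> psl M = psl N ->
  M = N \/ M = (- N).
Proof.
move=> dM dN e.
have dNV : (\det (invmx N) = 1) by rewrite det_inv dN GRing.invr1.
have uN : N \in unitmx by rewrite unitmxE dN GRing.unitr1.
have NV : (invmx N * N = 1) by apply: mulVmx.
have : pm1 (M * invmx N).
  apply/psl_eq1; first by rewrite det_mulmx dM dNV GRing.mulr1.
  rewrite pslM // e -pslM //.
  by rewrite (_ : (N * invmx N) = 1) ?psl1 //; apply: mulmxV.
rewrite -[M in M = _ \/ _]GRing.mulr1 -[M in _ \/ M = _]GRing.mulr1 -NV GRing.mulrA.
by case=> ->; rewrite ?GRing.mul1r ?GRing.mulN1r; auto.
Qed.

End Projection.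

(** * The Coxeter group *)
Section Involutions.
Local Open Scope group_scope.
Variable G : groupType.
Implicit Types y z : G.

Lemma exp23_eq1 y : y ^+ 2 = 1 -> y ^+ 3 = 1 -> y = 1.
Proof. by rewrite [y ^+ 3]expgSr => ->; rewrite mul1g. Qed.

Lemma exp25_eq1 y : y ^+ 2 = 1 -> y ^+ 5 = 1 -> y = 1.
Proof.
by move=> y2; rewrite [y ^+ 5](expgD y 2 3) y2 mul1g; apply: exp23_eq1.
Qed.

Lemma exp35_eq1 y : y ^+ 3 = 1 -> y ^+ 5 = 1 -> y = 1.
Proof.
by move=> y3; rewrite [y ^+ 5](expgD y 3 2) y3 mul1g => /exp23_eq1; apply.
Qed.

Lemma invol_eq y z n : y * y = 1 -> z * z = 1 ->
  (y * z) ^+ 2 = 1 -> (y * z) ^+ n.*2.+1 = 1 -> y = z.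
Proof.
move=> yy zz yz2; rewrite expgS -mul2n expgM yz2 expg1n mulg1 => yz.
by rewrite -[y]mulg1 -zz mulgA yz mul1g.
Qed.

Lemma invol_swap y z n :
  y * y = 1 -> z * z = 1 -> (y * z) ^+ n = 1 -> (z * y) ^+ n = 1.
Proof.
move=> yy zz yzn; suff -> : z * y = (y * z)^-1 by rewrite expVgn yzn invg1.
by apply: (mulgI (y * z)); rewrite mulgV -mulgA (mulgA z) zz mul1g yy.
Qed.

Lemma invol_commute y z :
  y * y = 1 -> z * z = 1 -> (y * z) ^+ 2 = 1 -> y * z = z * y.
Proof.
move=> yy zz yz; apply: (mulgI (y * z)); rewrite [LHS]yz.
by rewrite -mulgA (mulgA z) zz mul1g yy.
Qed.
End Involutions.

Section Coxeter.
Local Open Scope group_scope.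

Lemma ord4P (P : 'I_4 -> Prop) :
  P gen_a -> P gen_b -> P gen_c -> P gen_d -> forall i, P i.
Proof.
move=> Pa Pb Pc Pd [[|[|[|[|//]]]] lti].
- by rewrite (_ : Ordinal _ = gen_a) //; apply: val_inj.
- by rewrite (_ : Ordinal _ = gen_b) //; apply: val_inj.
- by rewrite (_ : Ordinal _ = gen_c) //; apply: val_inj.
- by rewrite (_ : Ordinal _ = gen_d) //; apply: val_inj.
Qed.

Lemma word_eval_wpow (G : groupType) (x : 'I_4 -> G) s n :
  word_eval x (wpow s n) = (\prod_(i <- s) x i) ^+ n.
Proof.
rewrite /word_eval /wpow; elim: n => [|n IHn]; first by rewrite big_nil expg0.
by rewrite /= big_cat IHn big_map expgS.
Qed.

(** Such families are the homomorphisms from Gamma to G. *)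
Definition coxeter353 (G : groupType) (x : 'I_4 -> G) :=
  forall r, r \in coxeter353_relators -> word_eval x r = 1.

Definition gamma (s : 'I_4) : Gamma := pres_gen coxeter353_relators s.

Lemma coxeter353P (G : groupType) (x : 'I_4 -> G) :
  let a := x gen_a in let b := x gen_b in let c := x gen_c in let d := x gen_d in
  coxeter353 x <->
  [/\ [/\ a ^+ 2 = 1, b ^+ 2 = 1, c ^+ 2 = 1 & d ^+ 2 = 1],
      [/\ (a * b) ^+ 3 = 1, (b * c) ^+ 5 = 1 & (c * d) ^+ 3 = 1] &
      [/\ (a * c) ^+ 2 = 1, (a * d) ^+ 2 = 1 & (b * d) ^+ 2 = 1]].
Proof.
move=> a b c d; split=> [rel|[[ra rb rc rd] [rab rbc rcd] [rac rad rbd]]].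
  have h s n : wpow s n \in coxeter353_relators -> (\prod_(i <- s) x i) ^+ n = 1.
    by move=> /rel; rewrite word_eval_wpow.
  have h1 s n := h [:: s] n; have h2 s t n := h [:: s; t] n.
  split; split.
  all: try by move: (h1 gen_a 2) (h1 gen_b 2) (h1 gen_c 2) (h1 gen_d 2);
    rewrite !big_seq1 !inE !eqxx ?orbT => h1a h1b h1c h1d;
    by [exact: h1a|exact: h1b|exact: h1c|exact: h1d].
  - by have := h2 gen_a gen_b 3; rewrite !big_cons big_nil mulg1; apply.
  - by have := h2 gen_b gen_c 5; rewrite !big_cons big_nil mulg1; apply.
  - by have := h2 gen_c gen_d 3; rewrite !big_cons big_nil mulg1; apply.
  - by have := h2 gen_a gen_c 2; rewrite !big_cons big_nil mulg1; apply.
  - by have := h2 gen_a gen_d 2; rewrite !big_cons big_nil mulg1; apply.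
  - by have := h2 gen_b gen_d 2; rewrite !big_cons big_nil mulg1; apply.
move=> r; rewrite /coxeter353_relators !inE.
by do ![case/orP]; move=> /eqP->;
  rewrite word_eval_wpow ?big_seq1 // !big_cons big_nil mulg1.
Qed.

Lemma gamma_coxeter : coxeter353 gamma.
Proof.
move=> r rR; suff -> : word_eval gamma r = pres_class _ r.
  by apply/pres_classP/pres_eq_relator.
rewrite /word_eval.
have posr : all (fun l => ~~ l.2) r.
  move: rR; rewrite !inE.
  by do ![case/orP]; move=> /eqP->.
elim: r posr {rR} => [|[s []] r IHr] //=; first by rewrite big_nil.
by move=> /IHr; rewrite big_cons /= => ->; apply: pres_mulE.
Qed.

Lemma coxeter_morph (G : groupType) (psi : Gamma -> G) :
  {morph psi : x y / x * y} -> coxeter353 (psi \o gamma).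
Proof.
move=> psiM; have psi1 : psi 1 = 1.
  by apply: (mulgI (psi 1)); rewrite -psiM !mulg1.
have psiX x n : psi (x ^+ n) = psi x ^+ n.
  by elim: n => [|n IHn]; rewrite ?expg0 // !expgS psiM IHn.
have [[ra rb rc rd] [rab rbc rcd] [rac rad rbd]] :=
  proj1 (coxeter353P gamma) gamma_coxeter.
by apply/coxeter353P; split; split; rewrite -?psiM -psiX ?ra ?rb ?rc ?rd ?rab
  ?rbc ?rcd ?rac ?rad ?rbd.
Qed.

Lemma gamma_sqr s : gamma s * gamma s = 1.
Proof.
have [[ra rb rc rd] _ _] := proj1 (coxeter353P gamma) gamma_coxeter.
elim/ord4P: s; [exact: ra|exact: rb|exact: rc|exact: rd].
Qed.

Lemma Gamma_word (x : Gamma) : exists w, x = \prod_(i <- w) gamma i.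
Proof.
rewrite -(pres_reprK x); elim: (generic_quotient.repr x) => [|[s e] u [w IHw]].
  by exists [::]; rewrite big_nil.
exists (s :: w); rewrite big_cons -IHw -cat1s -pres_mulE.
case: e => //; congr (_ * _); rewrite -[RHS]mul1g -(mulVg (gamma s)) -mulgA.
by rewrite gamma_sqr mulg1; symmetry; apply: pres_invE.
Qed.

Section Collapse.
Variables (G : groupType) (x : 'I_4 -> G).
Hypothesis rel : coxeter353 x.
Notation a := (x gen_a).
Notation b := (x gen_b).
Notation c := (x gen_c).
Notation d := (x gen_d).

(** If two neighbours agree, then the generator next to them commutes with both,
and commuting involutions whose product has odd order coincide. *)
Lemma coxeter_collapse : c = d \/ b = c \/ a = b -> [/\ a = b, b = c & c = d].
Proof.
have [[ra rb rc rd] [rab rbc rcd] [rac rad rbd]] := proj1 (coxeter353P x) rel.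
have cd_bc : c = d -> b = c.
  by move=> cd; apply: (invol_eq (n := 2)) => //; rewrite [c]cd.
have bc_ab : b = c -> a = b.
  by move=> bc; apply: (invol_eq (n := 1)) => //; rewrite [b]bc.
have bc_cd : b = c -> c = d.
  by move=> bc; apply: (invol_eq (n := 1)) => //; rewrite -[c]bc.
have ab_bc : a = b -> b = c.
  by move=> ab; apply: (invol_eq (n := 2)) => //; rewrite -[b]ab.
by case=> [/cd_bc|[|/ab_bc]] bc; split; auto.
Qed.

(** Any other coincidence makes the orders of two products coprime, and so
identifies two neighbours. *)
Lemma coxeter_distinct : a <> b ->
  [/\ [/\ a <> 1, b <> 1, c <> 1 & d <> 1], b <> c, c <> d &
      [/\ a <> c, a <> d & b <> d]].
Proof.
have [[ra rb rc rd] [rab rbc rcd] [rac rad rbd]] := proj1 (coxeter353P x) rel.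
move=> nab.
have nbc : b <> c.
  by move=> bc; case: nab; have [] := coxeter_collapse (or_intror (or_introl bc)).
have ncd : c <> d by move=> cd; case: nab; have [] := coxeter_collapse (or_introl cd).
have involM (y z : G) : z ^+ 2 = 1 -> y * z = 1 -> y = z.
  by move=> z2 yz; rewrite -[y]mulg1 -[1]z2 mulgA yz mul1g.
split=> //; split.
- by move=> a1; move: rab; rewrite [a]a1 mul1g => /(exp23_eq1 rb) b1; rewrite b1 in nab.
- by move=> b1; move: rab; rewrite [b]b1 mulg1 => /(exp23_eq1 ra) a1; rewrite a1 b1 in nab.
- by move=> c1; move: rcd; rewrite [c]c1 mul1g => /(exp23_eq1 rd) d1; rewrite c1 d1 in ncd.
- by move=> d1; move: rcd; rewrite [d]d1 mulg1 => /(exp23_eq1 rc) c1; rewrite c1 d1 in ncd.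
- by move=> ac; apply/nab/(involM _ _ rb)/exp35_eq1; rewrite // [a]ac; apply: invol_swap.
- move=> ad; apply: ncd; apply: (invol_eq (n := 1)) => //.
  by apply: invol_swap; rewrite // -[d]ad.
- by move=> bd; apply/nbc/(involM _ _ rc)/exp35_eq1; rewrite // [b]bd; apply: invol_swap.
Qed.
End Collapse.
End Coxeter.

(** * Four involutions satisfying the Coxeter relations *)
Section Classification.
Import GRing.Theory.
Local Open Scope ring_scope.

Section LiftTraces.
Variable F : finFieldType.
Implicit Types M N : 'M[F]_2.

Lemma psl_neq1 M : \det M = 1 -> psl M <> 1%g -> ~ pm1 M.
Proof. by move=> dM n1 /psl_eq1 -/(_ dM). Qed.

Lemma lift_involution M : \det M = 1 -> psl M <> 1%g -> (psl M ^+ 2 = 1)%g -> \tr M = 0.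
Proof.
move=> dM n1; rewrite -pslX // => e2; apply: trace_order2 => //.
  exact: psl_neq1.
by apply/psl_eq1; rewrite // det_mulmx dM mulr1.
Qed.

Lemma psl_mul_neq1 M N : \det M = 1 -> \det N = 1 -> (psl N ^+ 2 = 1)%g ->
  psl M <> psl N -> psl (M * N) <> 1%g.
Proof.
move=> dM dN N2 nMN; rewrite pslM // => MN1; apply: nMN.
by rewrite -[psl M]mulg1 -[1%g]N2 mulgA MN1 mul1g.
Qed.

Lemma pm1_pow M n : \det M = 1 -> (psl M ^+ n = 1)%g -> pm1 (M ^+ n).
Proof. by move=> dM e; apply/psl_eq1; rewrite ?det_pow // pslX. Qed.

Lemma sign_choice M N u : \det N = 1 -> \tr (M * N) ^+ 2 = u ^+ 2 ->
  exists N', [/\ \det N' = 1, psl N' = psl N & \tr (M * N') = u].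
Proof.
move=> dN /eqP; rewrite eqf_sqr => /orP[]/eqP e; first by exists N.
exists (- N); rewrite pslN // mulrN raddfN /= e opprK; split=> //.
by have [a [b [c [d eN]]]] := mx2P N; move: dN; rewrite eN !mx2E => <-; ring.
Qed.
End LiftTraces.

Lemma big_ord4 (V : nmodType) (f : 'I_4 -> V) :
  \sum_i f i = f gen_a + (f gen_b + (f gen_c + f gen_d)).
Proof.
by rewrite 4!big_ord_recl big_ord0 addr0; congr (f _ + (f _ + (f _ + f _)));
  apply: val_inj.
Qed.

(** Minus the traces of the products of lifts, reduced modulo 11: the entry 4 is a
solution of 4 s^2 = 9. *)
Definition gram4 (i j : 'I_4) : int :=
  nth 0 (nth [::] [:: [:: 2; 1; 0; 0]; [:: 1; 2; 4; 0];
                      [:: 0; 4; 2; 1]; [:: 0; 0; 1; 2]] i) j.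

Section FourInvolutions.
Variables (F : finFieldType) (x : 'I_4 -> coset_of (pmI F)).
Hypotheses (xL2 : forall i, x i \in L2 F) (rel : coxeter353 x).
Hypothesis nab : x gen_a <> x gen_b.

(** In characteristic 2 the lifts of commuting involutions commute, not only up to
sign.  So C and D commute with the nonscalar A, hence with each other, which
contradicts that cd has order 3. *)
Lemma char_neq2 : 2%:R != 0 :> F.
Proof.
apply/eqP=> p2.
have [[ra rb rc rd] [rab rbc rcd] [rac rad rbd]] := proj1 (coxeter353P x) rel.
have [[na nb nc nd] nbc ncd [nac nad nbd]] := coxeter_distinct rel nab.
have oppM (M : 'M[F]_2) : - M = M.
  by apply/esym/eqP; rewrite -subr_eq0 opprK -mulr2n -scaler_nat p2 scale0r.
have com (M N : 'M[F]_2) : \det M = 1 -> \det N = 1 -> (psl M ^+ 2 = 1)%g ->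
    (psl N ^+ 2 = 1)%g -> ((psl M * psl N) ^+ 2 = 1)%g -> M * N = N * M.
  move=> dM dN M2 N2 MN2.
  have : psl (M * N) = psl (N * M).
    rewrite !pslM //; apply: (mulgI (psl M * psl N)%g).
    transitivity (1%g : coset_of (pmI F)); first exact: MN2.
    rewrite -mulgA (mulgA (psl N)) (N2 : (psl N * psl N = 1)%g) mul1g.
    exact/esym/M2.
  by case/psl_eq; rewrite ?det_prod2 ?oppM.
have [A [dA eA]] := psl_surj (xL2 gen_a).
have [C [dC eC]] := psl_surj (xL2 gen_c).
have [D [dD eD]] := psl_surj (xL2 gen_d).
rewrite eA eC eD in ra rc rd rac rad rcd na ncd.
have nsA (z : F) : A <> z *: 1.
  move=> Az; have [|/eqP] := det1_free (x := 1) (y := z) dA (psl_neq1 dA na).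
    by rewrite scale1r.
  by rewrite oner_eq0.
have [u [v Cuv]] := commute_nonscalar nsA (com _ _ dA dC ra rc rac).
have [u' [v' Duv]] := commute_nonscalar nsA (com _ _ dA dD ra rd rad).
have CD : C * D = D * C.
  rewrite Cuv Duv; have [p [q [r [t ->]]]] := mx2P A.
  by rewrite mx2_1 !mx2E; apply/mx2_eqP; split; ring.
apply: ncd; apply: (invol_eq (n := 1)) => //.
rewrite [LHS](_ : _ = psl C * psl D * (psl C * psl D))%g //.
rewrite -[X in (X * _)%g]pslM // CD pslM //.
rewrite -mulgA (mulgA (psl C)) (rc : (psl C * psl C = 1)%g) mul1g; exact: rd.
Qed.

Lemma four_traces (X : 'I_4 -> 'M[F]_2) : (forall i, \det (X i) = 1) ->
    (forall i, psl (X i) = x i) ->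
  [/\ 11%:R = 0 :> F, forall i, \tr (X i) = 0,
      [/\ \tr (X gen_a * X gen_b) ^+ 2 = 1, \tr (X gen_b * X gen_c) ^+ 2 = 4%:R ^+ 2
      & \tr (X gen_c * X gen_d) ^+ 2 = 1] &
      [/\ \tr (X gen_a * X gen_c) = 0, \tr (X gen_a * X gen_d) = 0
      & \tr (X gen_b * X gen_d) = 0]].
Proof.
move=> dX eX.
have [[ra rb rc rd] [rab rbc rcd] [rac rad rbd]] := proj1 (coxeter353P x) rel.
have [[na nb nc nd] nbc ncd [nac nad nbd]] := coxeter_distinct rel nab.
have trX i : \tr (X i) = 0.
  by apply: lift_involution => //; rewrite eX; elim/ord4P: i.
have dXX i j : \det (X i * X j) = 1 by rewrite det_prod2.
have x2 i : (x i ^+ 2 = 1)%g by elim/ord4P: i.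
have nXX i j : x i <> x j -> ~ pm1 (X i * X j).
  by move=> nij; apply/psl_neq1/psl_mul_neq1; rewrite ?eX.
have pXX i j n : ((x i * x j) ^+ n = 1)%g -> pm1 ((X i * X j) ^+ n).
  by move=> e; apply: pm1_pow; rewrite // pslM // !eX.
have ac := trace_order2 (dXX _ _) (nXX _ _ nac) (pXX _ _ _ rac).
have ad := trace_order2 (dXX _ _) (nXX _ _ nad) (pXX _ _ _ rad).
have bd := trace_order2 (dXX _ _) (nXX _ _ nbd) (pXX _ _ _ rbd).
have ab := trace_order3 (dXX _ _) (nXX _ _ nab) (pXX _ _ _ rab).
have cd := trace_order3 (dXX _ _) (nXX _ _ ncd) (pXX _ _ _ rcd).
have bc := trace_order5 (dXX _ _) (nXX _ _ nbc) (pXX _ _ _ rbc).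
have trXX i : \tr (X i * X i) = - 2%:R.
  by rewrite sqr_det1 // trX scale0r add0r raddfN /= mxtrace1.
have := gram_det4 (trX gen_a) (trX gen_b) (trX gen_c) (trX gen_d).
rewrite /= !trXX ac ad bd ab cd; move: bc.
set s := \tr (X gen_b * X gen_c) => bc gram.
(* The Gram determinant of the path a - b - c - d. *)
have e94 : 9%:R - 4%:R * s ^+ 2 = 0 by rewrite -gram; ring.
have e11 : 11%:R = 0 :> F.
  (* Up to sign, 11 is the resultant of 9 - 4 S and S^2 - 3 S + 1. *)
  transitivity (- ((4%:R * s ^+ 2 - 3%:R) * (9%:R - 4%:R * s ^+ 2)
    + 16%:R * (s ^+ 4 - s ^+ 2 *+ 3 + 1)) : F); first by ring.
  by rewrite e94 bc !mulr0 addr0 oppr0.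
have n4 : 4%:R != 0 :> F by rewrite (natrM _ 2 2) mulf_neq0 ?char_neq2.
split=> //; split=> //; apply: (mulfI n4); apply/subr0_eq.
transitivity (- (9%:R - 4%:R * s ^+ 2) - 5%:R * 11%:R : F); first by ring.
by rewrite e94 e11 mulr0 oppr0 addr0.
Qed.

(** The pairs with nonzero trace form the path a - b - c - d, so that the signs can
be adjusted one generator at a time. *)
Lemma four_lift : exists X : 'I_4 -> 'M[F]_2,
  [/\ forall i, \det (X i) = 1, forall i, psl (X i) = x i &
      forall i j, \tr (X i * X j) = - (gram4 i j)%:~R].
Proof.
have [A [dA eA]] := psl_surj (xL2 gen_a).
have [B [dB eB]] := psl_surj (xL2 gen_b).
have [C [dC eC]] := psl_surj (xL2 gen_c).
have [D [dD eD]] := psl_surj (xL2 gen_d).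
pose lift A B C D (i : 'I_4) : 'M[F]_2 := nth 0 [:: A; B; C; D] i.
have lift_ok A' B' C' D' : \det A' = 1 -> \det B' = 1 -> \det C' = 1 ->
    \det D' = 1 -> psl A' = x gen_a -> psl B' = x gen_b -> psl C' = x gen_c ->
    psl D' = x gen_d -> (forall i, \det (lift A' B' C' D' i) = 1) /\
    (forall i, psl (lift A' B' C' D' i) = x i).
  by move=> *; split; elim/ord4P.
have [dl el] := lift_ok _ _ _ _ dA dB dC dD (esym eA) (esym eB) (esym eC) (esym eD).
have [_ _ [/= ab _ _] _] := four_traces dl el.
rewrite -(expr1n _ 2) -[RHS]sqrrN in ab.
have [B' [dB' eB' {}ab]] := sign_choice (M := A) dB ab; rewrite -eB in eB'.
have {dl el} [dl el] := lift_ok _ _ _ _ dA dB' dC dD (esym eA) eB' (esym eC) (esym eD).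
have [_ _ [/= _ bc _] _] := four_traces dl el.
rewrite -[RHS]sqrrN in bc.
have [C' [dC' eC' {}bc]] := sign_choice (M := B') dC bc; rewrite -eC in eC'.
have {dl el} [dl el] := lift_ok _ _ _ _ dA dB' dC' dD (esym eA) eB' eC' (esym eD).
have [_ _ [/= _ _ cd] _] := four_traces dl el.
rewrite -(expr1n _ 2) -[RHS]sqrrN in cd.
have [D' [dD' eD' {}cd]] := sign_choice (M := C') dD cd; rewrite -eD in eD'.
have {dl el} [dl el] := lift_ok _ _ _ _ dA dB' dC' dD' (esym eA) eB' eC' eD'.
have [_ tr0 _ [/= ac ad bd]] := four_traces dl el.
exists (lift A B' C' D'); split=> //.
have sq (M : 'M[F]_2) : \det M = 1 -> \tr M = 0 -> \tr (M * M) = - 2%:~R.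
  by move=> dM tM; rewrite sqr_det1 // tM scale0r add0r raddfN /= mxtrace1.
have trC (M N : 'M[F]_2) u : \tr (M * N) = u -> \tr (N * M) = u.
  by move<-; apply: mxtrace_mulC.
have := (tr0 gen_a, tr0 gen_b, tr0 gen_c, tr0 gen_d) => /= -[[[ta tb] tc] td].
elim/ord4P; elim/ord4P => /=; rewrite /gram4 /= ?oppr0 //; first [exact: sq|exact: trC].
Qed.

Lemma four_involutions_word (w : seq 'I_4) :
  (\prod_(i <- w) x i = 1)%g <-> forall k l, (11%:Z %| gram_defect gram4 w k l)%Z.
Proof.
have [X [dX eX grX]] := four_lift.
have [e11 trX _ _] := four_traces dX eX.
have p11 : 11%N \in [pchar F] by apply/andP; split=> //; apply/eqP.
have := psl_word w dX; rewrite (eq_bigr x) // => -[<- dw].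
rewrite psl_eq1 //.
rewrite (word_pm1 trX dX grX) ?char_neq2 //.
  by split=> gr k l; have := gr k l; rewrite (dvdz_pcharf p11) => /eqP.
move=> Z trZ; have [_ _ [ab bc cd] [ac _ _]] := four_traces dX eX.
pose t := \tr (X gen_a * X gen_b * X gen_c).
have t0 : t != 0.
  have n2 := char_neq2.
  apply/eqP=> t0; have := gram_det3 (trX gen_a) (trX gen_b) (trX gen_c).
  rewrite /= -/t t0 expr0n mul0rn oppr0 !grX /gram4 /= => e.
  have : (2%:R : F) ^+ 2 = 0.
    (* The Gram determinant of A, B, C is 26 = 4 modulo 11. *)
    have e26 : 26%:R = 0 :> F by rewrite [RHS]e; ring.
    transitivity (26%:R - 2%:R * 11%:R : F); first by ring.
    by rewrite e26 e11 mulr0 subr0.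
  by move/eqP; rewrite expf_eq0 (negPf n2).
pose T (Y : 'M[F]_2) := \tr Y / t.
exists (fun i : 'I_4 => nth 0 [:: T (Z * X gen_b * X gen_c);
  T (X gen_a * Z * X gen_c); T (X gen_a * X gen_b * Z)] i).
rewrite big_ord4 /= scale0r !addr0.
apply: (scalerI t0).
rewrite !scalerDr !scalerA /T !(mulrCA t) divff // !mulr1 addrA.
exact: tracefree_span.
Qed.
End FourInvolutions.
End Classification.

(** * Three involutions satisfying the relations of Delta *)
Section Three.
Import GRing.Theory.
Local Open Scope ring_scope.

Definition ord_p : 'I_3 := @Ordinal 3 0 isT.
Definition ord_q : 'I_3 := @Ordinal 3 1 isT.
Definition ord_r : 'I_3 := @Ordinal 3 2 isT.

Lemma ord3P (P : 'I_3 -> Prop) : P ord_p -> P ord_q -> P ord_r -> forall i, P i.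
Proof.
move=> Pp Pq Pr [[|[|[|//]]] lti].
- by rewrite (_ : Ordinal _ = ord_p) //; apply: val_inj.
- by rewrite (_ : Ordinal _ = ord_q) //; apply: val_inj.
- by rewrite (_ : Ordinal _ = ord_r) //; apply: val_inj.
Qed.

Lemma big_ord3 (V : nmodType) (f : 'I_3 -> V) :
  \sum_i f i = f ord_p + (f ord_q + f ord_r).
Proof.
by rewrite 3!big_ord_recl big_ord0 addr0; congr (f _ + (f _ + f _));
  apply: val_inj.
Qed.

(** The entry 6 is 1/2 modulo 11. *)
Definition gram3 (i j : 'I_3) : int :=
  nth 0 (nth [::] [:: [:: 2; 1; 1]; [:: 1; 2; 6]; [:: 1; 6; 2]] i) j.

Lemma F11_all (P : pred 'F_11) :
  all (fun n => P n%:R) (iota 0 11) -> forall v, P v.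
Proof.
move=> /allP Pn v; rewrite -[v]natr_Zp; apply: Pn.
by rewrite mem_iota; apply: ltn_ord.
Qed.

Lemma F11_char : 11%N \in [pchar 'F_11].
Proof. exact: pchar_Fp. Qed.

(** The quartic is (v - 5)^2 (v^2 + v + 7) modulo 11, and the discriminant 6 of the
second factor is not a square. *)
Lemma F11_trace (v : 'F_11) : let t2 := 2%:R - v - v ^+ 2 in
  t2 ^+ 2 - t2 *+ 3 + 1 = 0 -> v = 5%:R.
Proof.
move=> t2 /eqP e; apply/eqP; move: e; apply/implyP.
by move: v @t2; apply: F11_all; vm_compute.
Qed.

(** The images of ad, ac, bd are called p, q, r.  The hypothesis on the quartic holds
in F_11 and fails in the field with 121 elements; keeping F abstract prevents
evaluation in a concrete field. *)
Section ThreeInvolutions.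
Variables (F : finFieldType) (x : 'I_3 -> coset_of (pmI F)).
Hypotheses (p11 : 11%N \in [pchar F]) (quarticF : forall v : F,
  let t2 := 2%:R - v - v ^+ 2 in t2 ^+ 2 - t2 *+ 3 + 1 = 0 -> v = 5%:R).
Notation p := (x ord_p).
Notation q := (x ord_q).
Notation r := (x ord_r).
Hypotheses (xL2 : forall i, x i \in L2 F) (x2 : forall i, (x i ^+ 2 = 1)%g).
Hypotheses (pq3 : ((p * q) ^+ 3 = 1)%g) (pr3 : ((p * r) ^+ 3 = 1)%g).
Hypothesis rpq5 : ((r * p * q) ^+ 5 = 1)%g.
Hypothesis np : p <> 1%g.

Lemma three_distinct : [/\ q <> 1, r <> 1, p <> q, p <> r & r * p <> q]%g.
Proof.
have nq : q <> 1%g.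
  by move=> q1; apply/np/exp23_eq1 => //; move: pq3; rewrite q1 mulg1.
have nr : r <> 1%g.
  by move=> r1; apply/np/exp23_eq1 => //; move: pr3; rewrite r1 mulg1.
have nrp : (r * p <> q)%g.
  move=> rpq; apply/nq/exp23_eq1 => //; rewrite -rpq; apply: invol_swap pr3; exact: x2.
split=> // [pq|pr].
  apply/nr/exp25_eq1 => //; move: rpq5.
  by rewrite pq -mulgA (x2 ord_q : (q * q = 1)%g) mulg1.
apply/nq/exp25_eq1 => //; move: rpq5.
by rewrite pr (x2 ord_r : (r * r = 1)%g) mul1g.
Qed.

Lemma three_traces (P Q R : 'M[F]_2) :
    \det P = 1 -> \det Q = 1 -> \det R = 1 -> psl P = p -> psl Q = q -> psl R = r ->
    [/\ \tr P = 0, \tr Q = 0, \tr R = 0, \tr (P * Q) ^+ 2 = 1 & \tr (P * R) ^+ 2 = 1] /\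
    \tr (P * Q * R) ^+ 4 - \tr (P * Q * R) ^+ 2 *+ 3 + 1 = 0.
Proof.
have [nq nr npq npr nrpq] := three_distinct.
move=> dP dQ dR eP eQ eR; have dPQ := det_prod2 dP dQ; have dPR := det_prod2 dP dR.
split; first split.
- by apply: lift_involution; rewrite ?eP.
- by apply: lift_involution; rewrite ?eQ.
- by apply: lift_involution; rewrite ?eR.
- apply: trace_order3 => //; first by apply/psl_neq1/psl_mul_neq1; rewrite ?eP ?eQ.
  by apply: pm1_pow; rewrite // pslM // eP eQ.
- apply: trace_order3 => //; first by apply/psl_neq1/psl_mul_neq1; rewrite ?eP ?eR.
  by apply: pm1_pow; rewrite // pslM // eP eR.
have dRP := det_prod2 dR dP; have dRPQ := det_prod2 dRP dQ.
rewrite -(mxtrace_mulC R (P * Q) : \tr (R * (P * Q)) = _) mulrA.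
apply: trace_order5 => //.
  by apply/psl_neq1/psl_mul_neq1; rewrite // ?eQ // pslM // eR eP.
by apply: pm1_pow; rewrite // !pslM // eR eP eQ.
Qed.

(** The signs of Q and R are chosen to make the traces of PQ and PR equal to -1;
the trace v of QR is then a root of the quartic. *)
Lemma three_lift : exists X : 'I_3 -> 'M[F]_2,
  [/\ forall i, \det (X i) = 1, forall i, psl (X i) = x i, 
      forall i, \tr (X i) = 0,
      forall i j, \tr (X i * X j) = - (gram3 i j)%:~R &
      \tr (X ord_p * X ord_q * X ord_r) != 0].
Proof.
have [P [dP eP]] := psl_surj (xL2 ord_p).
have [Q [dQ eQ]] := psl_surj (xL2 ord_q).
have [R [dR eR]] := psl_surj (xL2 ord_r).
have [[_ _ _ pq pr] _] := three_traces dP dQ dR (esym eP) (esym eQ) (esym eR).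
rewrite -(expr1n _ 2) -[RHS]sqrrN in pq; rewrite -(expr1n _ 2) -[RHS]sqrrN in pr.
have [Q' [dQ' eQ' {}pq]] := sign_choice (M := P) dQ pq; rewrite -eQ in eQ'.
have [R' [dR' eR' {}pr]] := sign_choice (M := P) dR pr; rewrite -eR in eR'.
have [[tP tQ tR _ _] t5] := three_traces dP dQ' dR' (esym eP) eQ' eR'.
have sq (M : 'M[F]_2) : \det M = 1 -> \tr M = 0 -> \tr (M * M) = - 2%:R.
  by move=> dM tM; rewrite sqr_det1 // tM scale0r add0r raddfN /= mxtrace1.
have trC (M N : 'M[F]_2) u : \tr (M * N) = u -> \tr (N * M) = u.
  by move<-; apply: mxtrace_mulC.
have qr : \tr (Q' * R') = 5%:R.
  apply: quarticF; rewrite /=.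
  have := gram_det3 tP tQ tR; rewrite /= !sq // pq pr.
  move: t5; set t := \tr (P * Q' * R'); set v := \tr (Q' * R') => t5 e.
  (* The Gram determinant expresses the square of the trace of PQR through v. *)
  suff <- : t ^+ 2 = 2%:R - v - v ^+ 2 by rewrite -exprM.
  have n2 : - 2%:R != 0 :> F by rewrite oppr_eq0 -(dvdn_pcharf p11).
  by apply: (mulfI n2); rewrite mulNr mulr_natl e; ring.
have e56 : 5%:R = - 6%:~R :> F.
  by apply/eqP; rewrite -subr_eq0 opprK -natrD -(dvdn_pcharf p11).
exists (fun i : 'I_3 => nth 0 [:: P; Q'; R'] i); split.
- by elim/ord3P.
- by elim/ord3P.
- by elim/ord3P.
- elim/ord3P; elim/ord3P => /=; rewrite /gram3 /=; try by [exact: sq|exact: trC|].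
    by rewrite qr e56.
  by apply: trC; rewrite qr e56.
apply/eqP=> /= t0; move: t5; rewrite t0 !expr0n mul0rn subr0 add0r => /eqP.
by rewrite oner_eq0.
Qed.

Lemma three_involutions_word (w : seq 'I_3) :
  (\prod_(i <- w) x i = 1)%g <-> forall k l, (11%:Z %| gram_defect gram3 w k l)%Z.
Proof.
have [X [dX eX trX grX t0]] := three_lift.
have := psl_word w dX; rewrite (eq_bigr x) // => -[<- dw].
rewrite psl_eq1 // (word_pm1 trX dX grX) -?(dvdn_pcharf p11) //.
  by split=> gr k l; have := gr k l; rewrite (dvdz_pcharf p11) => /eqP.
move=> Z trZ; set t := \tr _ in t0.
pose T (Y : 'M[F]_2) := \tr Y / t.
exists (fun i : 'I_3 => nth 0 [:: T (Z * X ord_q * X ord_r);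
  T (X ord_p * Z * X ord_r); T (X ord_p * X ord_q * Z)] i).
rewrite big_ord3 /=.
apply: (scalerI t0).
rewrite !scalerDr !scalerA /T !(mulrCA t) divff // !mulr1 addrA.
exact: tracefree_span.
Qed.
End ThreeInvolutions.
End Three.

(** * Quotients and surjective homomorphisms *)
Section QuotientMaps.
Local Open Scope group_scope.
Local Open Scope classical_set_scope.
Variables (G : groupType) (aT : finGroupType).
Implicit Types (H N : set G) (A : {set aT}).

Definition lcoset_set N x : set G := set_mul [set x] N.

Lemma lcoset_setP N x y : lcoset_set N x y <-> N (x^-1 * y).
Proof.
split=> [[_ -> [n Nn <-]]|Nxy]; first by rewrite mulKg.
by exists x => //; exists (x^-1 * y) => //; rewrite mulVKg.
Qed.

Lemma subgroupV H x : subgroup H -> H x -> H x^-1.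
Proof. by case=> H1 Hd Hx; rewrite -[x^-1]mul1g; apply: Hd. Qed.

Lemma subgroupM H x y : subgroup H -> H x -> H y -> H (x * y).
Proof.
by move=> sH Hx Hy; rewrite -[y]invgK; case: (sH) => _; apply=> //; apply: subgroupV.
Qed.

Lemma lcoset_set_eq N x y : subgroup N ->
  lcoset_set N x = lcoset_set N y <-> N (x^-1 * y).
Proof.
move=> sN; split=> [e|Nxy].
  by apply/lcoset_setP; rewrite e; apply/lcoset_setP; rewrite mulVg; case: sN.
apply/seteqP; split=> z /lcoset_setP Nz; apply/lcoset_setP.
  rewrite -(mulKVg x z) mulgA; apply: subgroupM => //.
  by rewrite -[_ * x]invgK invMg invgK; apply: subgroupV.
by rewrite -(mulKVg y z) mulgA; apply: subgroupM.
Qed.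

Lemma lcoset_setM H N x y : normal_in N H -> H y ->
  set_mul (lcoset_set N x) (lcoset_set N y) = lcoset_set N (x * y).
Proof.
move=> [sN sH NH nN] Hy; apply/seteqP; split=> z.
  move=> [u /lcoset_setP Nu [v /lcoset_setP Nv <-]]; apply/lcoset_setP.
  have := subgroupM sN (nN _ _ Nu Hy) Nv.
  by rewrite conjgE invMg !mulgA mulgK.
move=> /lcoset_setP Nz; exists x; first by apply/lcoset_setP; rewrite mulVg; case: sN.
exists (x^-1 * z); last by rewrite mulVKg.
by apply/lcoset_setP; rewrite mulgA -invMg.
Qed.

(** The data of an isomorphism from H / N onto A, as a homomorphism on H.  It is
only required to be multiplicative on H, since Delta is a set of elements of
Gamma and not a group type. *)
Definition quotient_map H N A (psi : G -> aT) :=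
  [/\ forall x y, H x -> H y -> psi (x * y) = psi x * psi y,
      forall x, H x -> psi x \in A,
      forall y, y \in A -> exists2 x, H x & psi x = y &
      forall x, H x -> psi x = 1 <-> N x].

Lemma quotient_map_of_iso H N A f : normal_in N H -> quot_iso H N A f ->
  quotient_map H N A (f \o lcoset_set N).
Proof.
move=> nN [[fA finj fsurj] fM]; have [sN sH NH _] := nN.
have cosH x : H x -> coset_set N H (lcoset_set N x) by exists x.
have psiM x y : H x -> H y -> f (lcoset_set N (x * y)) =
    f (lcoset_set N x) * f (lcoset_set N y).
  by move=> Hx Hy; rewrite -(lcoset_setM _ nN) // fM //; apply: cosH.
have H1 : H 1 by case: sH.
have psi1 : f (lcoset_set N 1) = 1.
  by apply: (mulgI (f (lcoset_set N 1))); rewrite -psiM // !mulg1.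
split=> //=.
- by move=> x /cosH /fA.
- by move=> y /fsurj[_ [x Hx <-] <-]; exists x.
- move=> x Hx; rewrite -psi1; split=> [/finj e|Nx].
    rewrite -[x]mul1g -[1]invg1; apply/lcoset_set_eq => //.
    by symmetry; apply: e; rewrite inE; apply: cosH.
  by congr f; symmetry; apply/lcoset_set_eq; rewrite // invg1 mul1g.
Qed.

Lemma iso_of_quotient_map H N A psi :
  subgroup H -> N `<=` H -> quotient_map H N A psi ->
  normal_in N H /\
  exists2 f, quot_iso H N A f & forall x, H x -> f (lcoset_set N x) = psi x.
Proof.
move=> sH NH [psiM psiA psi_onto kerN]; have H1 : H 1 by case: sH.
have psi1 : psi 1 = 1 by apply: (mulgI (psi 1)); rewrite -psiM // !mulg1.
have psiV x : H x -> psi x^-1 = (psi x)^-1.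
  move=> Hx; apply: (mulgI (psi x)); rewrite -psiM ?mulgV //.
  exact: subgroupV.
have sN : subgroup N.
  split=> [|x y Nx Ny]; first by apply/kerN.
  have [Hx Hy] := (NH _ Nx, NH _ Ny); apply/kerN; first by case: sH => _; apply.
  rewrite psiM //; last exact: subgroupV.
  by rewrite psiV // (proj2 (kerN _ Hx)) // (proj2 (kerN _ Hy)) // mulgV.
have eqP x y : H x -> H y -> lcoset_set N x = lcoset_set N y <-> psi x = psi y.
  move=> Hx Hy; rewrite lcoset_set_eq // -kerN; last first.
    by apply: subgroupM => //; apply: subgroupV.
  rewrite psiM //; last exact: subgroupV.
  rewrite psiV //; split=> [e|->]; last by rewrite mulVg.
  by apply: (mulgI (psi x)^-1); rewrite mulVg e.
have nN : normal_in N H.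
  split=> // x h Nx Hh; have Hx := NH _ Nx; have HV := subgroupV sH Hh.
  rewrite conjgE -kerN; last by do 2?[apply: subgroupM => //].
  rewrite !psiM ?psiV //; last exact: subgroupM.
  by rewrite (proj2 (kerN _ Hx)) // mul1g mulVg.
split=> //.
pose f X := psi (xget 1 [set x | H x /\ lcoset_set N x = X]).
have fE x : H x -> f (lcoset_set N x) = psi x.
  rewrite /f; case: xgetP => [y -> [Hy eyx] Hx|/(_ x) no Hx]; last by case: no.
  exact/eqP.
exists f => //; split; last first.
  move=> _ _ [x Hx <-] [y Hy <-]; rewrite (lcoset_setM _ nN) // !fE ?psiM //.
  exact: subgroupM.
split=> [_ [x Hx <-]|X Y|y /psi_onto[x Hx <-]].
- by rewrite [f _]fE //=; apply: psiA.
- rewrite !inE => -[x Hx <-] [y Hy <-]; rewrite ![f _]fE // => e.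
  exact/eqP.
- by exists (lcoset_set N x); [exists x|rewrite [f _]fE].
Qed.
End QuotientMaps.

Lemma subgroupT (G : groupType) : subgroup (@setT G).
Proof. by []. Qed.

(** * Homomorphisms from Gamma and from Delta to L_2(F) *)
Section GammaMaps.
Local Open Scope group_scope.

Lemma morph_word (G : groupType) (psi : Gamma -> G) (I : Type) (x : I -> Gamma) w :
  {morph psi : x y / x * y} -> psi (\prod_(i <- w) x i) = \prod_(i <- w) psi (x i).
Proof.
move=> psiM; elim: w => [|i w IHw]; last by rewrite !big_cons psiM IHw.
by rewrite !big_nil; apply: (mulgI (psi 1)); rewrite -psiM !mulg1.
Qed.

Lemma constant_word (G : groupType) (psi : Gamma -> G) e w :
  {morph psi : x y / x * y} -> (forall s, psi (gamma s) = e) -> e * e = 1 -> e <> 1 ->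
  psi (\prod_(i <- w) gamma i) = 1 <-> ~~ odd (size w).
Proof.
move=> psiM psie ee ne; rewrite morph_word //.
have -> : \prod_(i <- w) psi (gamma i) = if odd (size w) then e else 1.
  elim: w => [|s w IHw]; first by rewrite big_nil.
  by rewrite big_cons IHw psie /=; case: odd; rewrite /= ?mulg1.
by case: odd.
Qed.

Lemma Delta_word w : Delta (\prod_(i <- w) gamma i) <-> ~~ odd (size w).
Proof.
apply: (constant_word (psi := parity) (e := 1%R : 'Z_2)) => [|s||/eqP] //.
- exact: parityM.
- exact: parity_gen.
- by apply/eqP.
Qed.

(** In the last case the condition does not depend on psi, nor on F: there is a single
such kernel. *)
Lemma Gamma_kernel (F : finFieldType) (psi : Gamma -> coset_of (pmI F)) :
  {morph psi : x y / x * y} -> (forall x, psi x \in L2 F) ->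
  [\/ forall x, psi x = 1, forall x, psi x = 1 <-> Delta x |
      forall w, psi (\prod_(i <- w) gamma i) = 1 <->
         forall k l, (11%:Z %| gram_defect gram4 w k l)%Z].
Proof.
move=> psiM psiL; have rel := coxeter_morph psiM.
have [/= ab|nab] := pselect (psi (gamma gen_a) = psi (gamma gen_b)); last first.
  constructor 3=> w; rewrite morph_word //.
  exact: (four_involutions_word (x := psi \o gamma) (fun s => psiL _) rel nab w).
have [|/= _ bc cd] := coxeter_collapse rel; first by right; right.
pose e := psi (gamma gen_a).
have psie s : psi (gamma s) = e by elim/ord4P: s; rewrite /e ?ab ?bc ?cd.
have ee : e * e = 1 by have [[]] := proj1 (coxeter353P _) rel.
have [e1|ne] := pselect (e = 1).
  constructor 1=> x; have [w ->] := Gamma_word x; rewrite morph_word //.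
  by rewrite big1_seq // => s _; rewrite psie.
constructor 2=> x; have [w ->] := Gamma_word x.
by rewrite Delta_word; apply: constant_word ne.
Qed.

(** Involutions generating Delta: ad, ac and bd. *)
Definition pqr (i : 'I_3) : Gamma :=
  nth 1 [:: gamma gen_a * gamma gen_d; gamma gen_a * gamma gen_c;
            gamma gen_b * gamma gen_d] i.

(** An even word is a product of pairs st = (sa)(at), and the products of a with a
generator are words in ad, ac and bd. *)
Lemma Delta_pqr x : Delta x -> exists w, x = \prod_(i <- w) pqr i.
Proof.
pose S x := exists w, x = \prod_(i <- w) pqr i.
have S1 : S 1 by exists [::]; rewrite big_nil.
have SM y z : S y -> S z -> S (y * z).
  by move=> [v ->] [w ->]; exists (v ++ w); rewrite big_cat.
have Sg i : S (pqr i) by exists [:: i]; rewrite big_seq1.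
have [_ _ [rac rad rbd]] := proj1 (coxeter353P gamma) gamma_coxeter.
have com s t := invol_commute (gamma_sqr s) (gamma_sqr t).
have dd y : y * gamma gen_d * gamma gen_d = y by rewrite -mulgA gamma_sqr mulg1.
have Sa s : S (gamma gen_a * gamma s) /\ S (gamma s * gamma gen_a).
  elim/ord4P: s.
  - by rewrite gamma_sqr.
  - split.
      rewrite (_ : _ * _ = pqr ord_p * pqr ord_r); first exact: SM.
      by rewrite /pqr /= (com _ _ rbd) mulgA dd.
    rewrite (_ : _ * _ = pqr ord_r * pqr ord_p); first exact: SM.
    by rewrite /pqr /= (com _ _ rad) mulgA dd.
  - by rewrite -(com _ _ rac); split; apply: (Sg ord_q).
  - by rewrite -(com _ _ rad); split; apply: (Sg ord_p).
have [w ->] := Gamma_word x; rewrite Delta_word.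
have [n] := ubnP (size w); elim: n w => // n IHn [|s [|t w]] //=.
  by rewrite big_nil.
rewrite !ltnS negbK => /ltnW ltn ev; rewrite !big_cons mulgA.
apply: (SM); last exact: IHn.
rewrite -[gamma s]mulg1 -(gamma_sqr gen_a) !mulgA.
by rewrite -mulgA; apply: SM; [apply: (Sa s).2|apply: (Sa t).1].
Qed.

Lemma pqr_Delta i : Delta (pqr i).
Proof.
by elim/ord3P: i; rewrite /Delta /= parityM !parity_gen; apply/eqP.
Qed.
End GammaMaps.

Section DeltaKernel.
Local Open Scope group_scope.

Lemma normal_Delta : normal_in Delta setT /\ quot_isog setT Delta C2.
Proof.
have [||nD [f isof _]] :=
  @iso_of_quotient_map _ _ setT Delta C2 parity (subgroupT _); last by split; last exists f.
- by [].
- split=> // [x y _ _|y _]; first exact: parityM.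
  have [->|->] : y = 1 \/ y = 1%R.
      by case: y => [[|[|//]] lty]; [left|right]; apply: val_inj.
    exists 1 => //; have := Delta_word [::].
    by rewrite big_nil => -[_ /(_ isT)].
  by exists (gamma gen_a) => //; apply: parity_gen.
Qed.

Lemma subgroup_Delta : subgroup Delta.
Proof. by have [[]] := normal_Delta. Qed.

Lemma pqr_rel :
  [/\ forall i, pqr i ^+ 2 = 1, (pqr ord_p * pqr ord_q) ^+ 3 = 1,
      (pqr ord_p * pqr ord_r) ^+ 3 = 1 & (pqr ord_r * pqr ord_p * pqr ord_q) ^+ 5 = 1].
Proof.
have [_ [rab rbc rcd] [rac rad rbd]] := proj1 (coxeter353P gamma) gamma_coxeter.
have com s t := invol_commute (gamma_sqr s) (gamma_sqr t).
have cancel s y : y * gamma s * gamma s = y by rewrite -mulgA gamma_sqr mulg1.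
split; first by elim/ord3P.
- rewrite /pqr /= (com _ _ rad) mulgA cancel.
  by apply: invol_swap rcd; apply: gamma_sqr.
- by rewrite /pqr /= (com _ _ rbd) mulgA cancel.
- rewrite /pqr /= (com _ _ rad) !mulgA cancel.
  by rewrite cancel.
Qed.

(** The condition does not depend on psi, so there is a single such kernel. *)
Lemma Delta_kernel (F : finFieldType) (psi : Gamma -> coset_of (pmI F)) :
  11%N \in [pchar F]%R ->
  (forall v : F, let t2 := (2%:R - v - v ^+ 2)%R in
     (t2 ^+ 2 - t2 *+ 3 + 1 = 0)%R -> v = 5%:R%R) ->
  (forall x y, Delta x -> Delta y -> psi (x * y) = psi x * psi y) ->
  (forall x, Delta x -> psi x \in L2 F) -> (exists2 x, Delta x & psi x <> 1) ->
  forall w, psi (\prod_(i <- w) pqr i) = 1 <->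
     forall k l, (11%:Z %| gram_defect gram3 w k l)%Z.
Proof.
move=> p11 trF psiM psiL [x Dx nx] w.
have [D1 Dd] := subgroup_Delta; have sD := subgroup_Delta.
have psi1 : psi 1 = 1 by apply: (mulgI (psi 1)); rewrite -psiM // !mulg1.
have psiw u : Delta (\prod_(i <- u) pqr i) /\
    psi (\prod_(i <- u) pqr i) = \prod_(i <- u) psi (pqr i).
  elim: u => [|i u [IH1 IH2]]; first by rewrite !big_nil.
  have Di := pqr_Delta i.
  by rewrite !big_cons psiM // IH2; split=> //; apply: subgroupM.
have psiX y n : Delta y -> Delta (y ^+ n) /\ psi (y ^+ n) = psi y ^+ n.
  move=> Dy; elim: n => [|n [IH1 IH2]]; first by rewrite !expg0.
  by rewrite !expgS psiM // IH2; split=> //; apply: subgroupM.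
have [r2 rpq rpr rrpq] := pqr_rel.
have D2 i j : Delta (pqr i * pqr j) by apply: (subgroupM sD); apply: pqr_Delta.
have q2 i : psi (pqr i) ^+ 2 = 1.
  by rewrite -(proj2 (psiX _ _ _)) ?r2 //; apply: pqr_Delta.
have qM i j : psi (pqr i) * psi (pqr j) = psi (pqr i * pqr j).
  by rewrite psiM //; apply: pqr_Delta.
have qpq : (psi (pqr ord_p) * psi (pqr ord_q)) ^+ 3 = 1.
  by rewrite qM -(proj2 (psiX _ _ _)) ?rpq.
have qpr : (psi (pqr ord_p) * psi (pqr ord_r)) ^+ 3 = 1.
  by rewrite qM -(proj2 (psiX _ _ _)) ?rpr.
have qrpq : (psi (pqr ord_r) * psi (pqr ord_p) * psi (pqr ord_q)) ^+ 5 = 1.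
  rewrite qM -psiM //; last exact: pqr_Delta.
  rewrite -(proj2 (psiX _ _ _)) ?rrpq //.
  by apply: (subgroupM sD) => //; apply: pqr_Delta.
have np : psi (pqr ord_p) <> 1.
  move=> p1; apply: nx; have [u ->] := Delta_pqr Dx.
  rewrite (proj2 (psiw u)) big1_seq // => i _.
  elim/ord3P: i => //; apply: exp23_eq1 => //.
    by rewrite p1 mul1g in qpq.
  by rewrite p1 mul1g in qpr.
rewrite (proj2 (psiw w)).
apply: (three_involutions_word (x := fun i => psi (pqr i))) => //.
by move=> i; apply/psiL/pqr_Delta.
Qed.
End DeltaKernel.

(** * An explicit homomorphism from Gamma onto L_2(11) *)
Section Transvections.
Import GRing.Theory.
Local Open Scope ring_scope.

Lemma SL2_transvections (F : fieldType) (P : 'M[F]_2 -> Prop) :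
  (forall M N, \det M = 1 -> \det N = 1 -> P M -> P N -> P (M * N)) ->
  (forall v, P (mx2 1 v 0 1)) -> (forall v, P (mx2 1 0 v 1)) ->
  forall M, \det M = 1 -> P M.
Proof.
move=> PM PU PL M; have [a [b [c [d ->]]]] := mx2P M.
have dU v : \det (mx2 1 v 0 1) = 1 :> F by rewrite mx2E; ring.
have dL v : \det (mx2 1 0 v 1) = 1 :> F by rewrite mx2E; ring.
have gen a' b' c' d' : c' != 0 -> \det (mx2 a' b' c' d') = 1 -> P (mx2 a' b' c' d').
  rewrite mx2E => nc det1M.
  have -> : mx2 a' b' c' d' =
      mx2 1 ((a' - 1) / c') 0 1 * mx2 1 0 c' 1 * mx2 1 ((d' - 1) / c') 0 1.
    rewrite !mx2E; apply/mx2_eqP; split; try by field.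
    have -> : b' = (a' * d' - 1) / c'.
      by rewrite -det1M; field.
    by field.
  by apply: (PM); rewrite ?det_prod2 //; apply: (PM).
have [c0|nc] := eqVneq c 0; last exact: gen.
rewrite c0 mx2E => det1M.
have na : a != 0.
  apply/eqP=> a0; move: det1M; rewrite a0 mul0r mulr0 subr0 => /eqP.
  by rewrite eq_sym oner_eq0.
have -> : mx2 a b 0 d = mx2 1 0 (- 1) 1 * mx2 a b a (b + d).
  by rewrite mx2E; apply/mx2_eqP; split; ring.
apply: (PM) => //.
  by rewrite mx2E -det1M; ring.
by apply: gen; rewrite // mx2E -det1M; ring.
Qed.

Lemma Fp_SL2_transvections (p : nat) (P : 'M['F_p]_2 -> Prop) :
  (forall M N, \det M = 1 -> \det N = 1 -> P M -> P N -> P (M * N)) -> P 1 ->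
  P (mx2 1 1 0 1) -> P (mx2 1 0 1 1) -> forall M, \det M = 1 -> P M.
Proof.
move=> PM P1 PU PL.
have transv (T : 'F_p -> 'M['F_p]_2) :
    (forall v, \det (T v) = 1) -> T 0 = 1 -> (forall v, T (v + 1) = T v * T 1) ->
    P (T 1) -> forall v, P (T v).
  move=> dT T0 TD PT v; rewrite -[v]natr_Zp; elim: (v : nat) => [|n IHn].
    by rewrite T0.
  by rewrite mulrSr TD; apply: PM.
apply: SL2_transvections => //; apply: transv => //; try by rewrite mx2_1.
- by move=> v; rewrite mx2_det mulr0 mulr1 subr0.
- by move=> v; rewrite mx2M !(mulr0, mul0r, mulr1, mul1r, addr0, add0r) addrC.
- by move=> v; rewrite mx2_det mul0r mulr1 subr0.
- by move=> v; rewrite mx2M !(mulr0, mul0r, mulr1, mul1r, addr0, add0r).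
Qed.
End Transvections.

Section Explicit.
Import GRing.Theory.
Local Open Scope ring_scope.

Section Quads.
Variable F : finFieldType.

(** A product of matrices with concrete entries does not reduce by computation, a
product of quadruples does. *)
Definition quad := (F * F * F * F)%type.
Definition quad_mx (u : quad) : 'M[F]_2 :=
  let: (a, b, c, d) := u in mx2 a b c d.
Definition quad_mul (u v : quad) : quad :=
  let: (a, b, c, d) := u in let: (a', b', c', d') := v in
  (a * a' + b * c', a * b' + b * d', c * a' + d * c', c * b' + d * d').
Definition quad_opp (u : quad) : quad :=
  let: (a, b, c, d) := u in (- a, - b, - c, - d).
Definition quad_word (I : Type) (q : I -> quad) (w : seq I) : quad :=
  foldr (fun i => quad_mul (q i)) (1, 0, 0, 1) w.

Lemma psl_quad_word (I : Type) (q : I -> quad) w u :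
  (forall i, \det (quad_mx (q i)) = 1) ->
  (quad_word q w == u) || (quad_word q w == quad_opp u) ->
  (\prod_(i <- w) psl (quad_mx (q i)))%g = psl (quad_mx u).
Proof.
move=> dq e; have [<- dw] := psl_word w dq.
have wE : \prod_(i <- w) quad_mx (q i) = quad_mx (quad_word q w).
  elim: {e dw} w => [|i w IHw]; first by rewrite big_nil mx2_1.
  rewrite big_cons IHw /=.
  case: (q i) => [[[a b] c] d]; case: quad_word => [[[a' b'] c'] d'] /=.
  by rewrite mx2M.
case/orP: e wE => /eqP-> wE; first by rewrite wE.
rewrite -[LHS]pslN // wE; congr psl.
by case: u {wE} => [[[a b] c] d] /=; rewrite mx2N !opprK.
Qed.
End Quads.

(** A solution of tr(X_i X_j) = - gram4 i j in traceless matrices of determinant 1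
over F_11. *)
Definition reflection_quad (i : 'I_4) : quad 'F_11 :=
  nth (1, 0, 0, 1) [:: (0, -1, 1, 0); (3%:R, 3%:R, 4%:R, 8%:R);
    (1, 8%:R, 8%:R, -1); (8%:R, 1, 1, 3%:R)] i.
Definition reflection_mx i := quad_mx (reflection_quad i).

Lemma det_reflection i : \det (reflection_mx i) = 1.
Proof. by elim/ord4P: i; rewrite mx2_det; apply/eqP; vm_compute. Qed.

Lemma reflection_word w u :
  let v := quad_word reflection_quad w in (v == u) || (v == quad_opp u) ->
  (\prod_(i <- w) psl (reflection_mx i))%g = psl (quad_mx u).
Proof. exact: psl_quad_word det_reflection. Qed.

Lemma reflection_coxeter : coxeter353 (fun i => psl (reflection_mx i)).
Proof.
pose one : quad 'F_11 := (1, 0, 0, 1).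
pose ok w := let v := quad_word reflection_quad w in (v == one) || (v == quad_opp one).
have chk : all (fun r => all (fun l => ~~ l.2) r && ok (unzip1 r)) coxeter353_relators.
  by vm_compute.
move=> r /(allP chk) /andP[pos e].
have -> : word_eval (fun i => psl (reflection_mx i)) r =
    (\prod_(i <- unzip1 r) psl (reflection_mx i))%g.
  rewrite /word_eval big_map big_seq [RHS]big_seq; apply: eq_bigr => l lr.
  by move/allP: pos => /(_ l lr) /negPf->.
rewrite (reflection_word (w := unzip1 r) (u := one) e).
have -> : quad_mx one = 1 by symmetry; exact: mx2_1.
exact: psl1.
Qed.

(** The projection of Gamma to L_2(11); the generators go to involutions. *)
Definition phi : Gamma -> coset_of (pmI 'F_11) :=
  pres_lift (fun i => psl (reflection_mx i)).

Lemma phiM : {morph phi : x y / (x * y)%g}.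
Proof. exact: pres_liftM reflection_coxeter. Qed.

Lemma phi_gamma s : phi (gamma s) = psl (reflection_mx s).
Proof. exact: pres_lift_gen reflection_coxeter s. Qed.

Lemma phi_word w :
  phi (\prod_(i <- w) gamma i)%g = (\prod_(i <- w) psl (reflection_mx i))%g.
Proof. by rewrite (morph_word _ _ phiM); apply: eq_bigr => i _; apply: phi_gamma. Qed.

Lemma phi_L2 x : phi x \in L2 'F_11.
Proof.
have [w ->] := Gamma_word x; rewrite phi_word.
by have [<- dw] := psl_word w det_reflection; apply: psl_in.
Qed.

(** Transvections generate SL_2(11), and the elementary ones are, up to sign, the
images of abdcbc and acbcbd. *)
Lemma phi_onto y : y \in L2 'F_11 -> exists2 x, Delta x & phi x = y.
Proof.
move=> /psl_surj[M [dM ->]]; have sD := subgroup_Delta.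
pose P (M : 'M['F_11]_2) := exists2 x, Delta x & phi x = psl M.
have PM M1 M2 : \det M1 = 1 -> \det M2 = 1 -> P M1 -> P M2 -> P (M1 * M2).
  move=> d1 d2 [x Dx e1] [x' Dx' e2]; exists (x * x')%g; first exact: subgroupM.
  by rewrite phiM e1 e2 pslM.
have P1 : P 1 by exists 1%g; [case: sD|have := phi_word [::]; rewrite !big_nil psl1].
have Pword w u : ~~ odd (size w) ->
    (let v := quad_word reflection_quad w in (v == u) || (v == quad_opp u)) ->
    P (quad_mx u).
  move=> ew e; exists (\prod_(i <- w) gamma i)%g; first exact/Delta_word.
  by rewrite phi_word; apply: reflection_word.
pose a := gen_a; pose b := gen_b; pose c := gen_c; pose d := gen_d.
apply: (Fp_SL2_transvections (P := P)) dM; [exact: PM|exact: P1| |].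
- by apply: (Pword [:: a; b; d; c; b; c] (1, 1, 0, 1)); vm_compute.
- by apply: (Pword [:: a; c; b; c; b; d] (1, 0, 1, 1)); vm_compute.
Qed.
End Explicit.

(** * The normal subgroups *)
Section Final.
Local Open Scope ring_scope.
Local Open Scope group_scope.
Local Open Scope classical_set_scope.

Definition N0 : set Gamma := [set x | phi x = 1].
Definition K0 : set Gamma := Delta `&` N0.

(** Transvections: this separates L_2(F) from groups of order 2. *)
Lemma L2_large_order (F : finFieldType) : 2%:R%R != 0%R :> F ->
  exists2 y, y \in L2 F & y <> 1 /\ y * y <> 1.
Proof.
move=> n2; have dU (v : F) : \det (mx2 1 v 0 1)%R = 1%R.
  by rewrite mx2_det GRing.mulr1 GRing.mulr0 GRing.subr0.
have n1 (v : F) : v != 0%R -> psl (mx2 1 v 0 1)%R <> 1.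
  move=> nv /psl_eq1-/(_ (dU v)) []; rewrite mx2_1 ?mx2N => /mx2_eqP[].
    by move=> _ v0; rewrite v0 eqxx in nv.
  by move=> _ v0; rewrite v0 GRing.oppr0 eqxx in nv.
exists (psl (mx2 1 1 0 1)%R); first exact: psl_in.
split; first by apply: n1; apply: GRing.oner_neq0.
rewrite -pslM // mx2M !(GRing.mulr1, GRing.mulr0, GRing.addr0, GRing.add0r).
exact: n1.
Qed.

Lemma L2_involution (F : finFieldType) :
  exists2 e, e \in L2 F & e <> 1 /\ e * e = 1.
Proof.
pose M : 'M[F]_2 := mx2 0%R (-1)%R 1%R 0%R.
have dM : \det M = 1%R.
  by rewrite mx2_det GRing.mulr0 GRing.mulr1 GRing.sub0r GRing.opprK.
exists (psl M); first exact: psl_in.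
split.
  move=> /psl_eq1-/(_ dM); rewrite /pm1 mx2_1 mx2N => -[] /mx2_eqP[_ _ /eqP].
    by rewrite GRing.oner_eq0.
  by rewrite GRing.oppr0 GRing.oner_eq0.
rewrite -pslM //; apply/psl_eq1; first by rewrite det_prod2.
by right; rewrite mx2_1 /M mx2M mx2N; apply/mx2_eqP; split; ring.
Qed.

Lemma L2_11_large_order : exists2 y, y \in L2 'F_11 & y <> 1 /\ y * y <> 1.
Proof. by apply: L2_large_order; rewrite -(GRing.dvdn_pcharf F11_char). Qed.

Lemma phi_neq1 : exists2 x, Delta x & phi x <> 1.
Proof.
by have [y /phi_onto[x Dx <-] [ny _]] := L2_11_large_order; exists x.
Qed.

Lemma N0_map : quotient_map setT N0 (L2 'F_11) phi.
Proof.
split=> // [x y _ _|x _|y /phi_onto[x _ <-]]; [exact: phiM|exact: phi_L2|by exists x].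
Qed.

Lemma normal_N0 : normal_in N0 setT /\ quot_isog setT N0 (L2 'F_11).
Proof.
have [//|nN [f isof _]] := iso_of_quotient_map (subgroupT Gamma) _ N0_map.
by split; last exists f.
Qed.

Lemma is_K0_K0 : is_K0 K0.
Proof.
have [||nK [f isof _]] :=
  @iso_of_quotient_map _ _ Delta K0 (L2 'F_11) phi subgroup_Delta.
- by move=> x [].
- split=> [x y _ _|x _|//|x Dx].
  + exact: phiM.
  + exact: phi_L2.
  + exact: phi_onto.
  + by split=> [|[]].
by split; last exists f.
Qed.

Lemma is_K0_unique K : is_K0 K -> K0 = K.
Proof.
move=> [nK [f isof]]; have [psiM psiL psi_onto kerK] := quotient_map_of_iso nK isof.
have [_ _ KD _] := nK.
have psin : exists2 x, Delta x & (f \o lcoset_set K) x <> 1.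
  by have [y /psi_onto[x Dx <-] [ny _]] := L2_11_large_order; exists x.
have k1 := Delta_kernel F11_char F11_trace psiM psiL psin.
have k2 := Delta_kernel F11_char F11_trace
  (fun x y _ _ => phiM x y) (fun x _ => phi_L2 x) phi_neq1.
have eqk x : Delta x -> N0 x <-> K x.
  move=> Dx; rewrite -kerK //; have [w ->] := Delta_pqr Dx.
  by rewrite k1 /N0 /= k2.
apply/seteqP; split=> x; first by move=> [Dx /eqk]; apply.
by move=> Kx; split; [apply: KD|apply/eqk => //; apply: KD].
Qed.

(** The map phi falls itself under the last case of [Gamma_kernel], since it is
nontrivial on Delta; this identifies the common kernel as N0. *)
Lemma Gamma_kernel_cases (F : finFieldType) (psi : Gamma -> coset_of (pmI F)) :
  {morph psi : x y / x * y} -> (forall x, psi x \in L2 F) ->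
  [\/ forall x, psi x = 1, forall x, psi x = 1 <-> Delta x |
      forall x, psi x = 1 <-> N0 x].
Proof.
move=> psiM psiL; case: (Gamma_kernel psiM psiL) => [?|?|k1].
- by constructor 1.
- by constructor 2.
constructor 3=> x; have [w ->] := Gamma_word x; rewrite k1 /N0 /=.
have [x0 D0 n0] := phi_neq1.
case: (Gamma_kernel phiM phi_L2) => [phi1|phiD|k2]; last by rewrite k2.
  by case: n0.
by case: n0; apply/phiD.
Qed.

Lemma quotient_kernel N : normal_in N setT -> N <> setT -> quot_in_some_L2 N ->
  N = Delta \/ N = N0.
Proof.
move=> nN nT [F [H [_ HL [f isof]]]].
have [psiM psiH _ kerN] := quotient_map_of_iso nN isof.
have psiM' : {morph (f \o lcoset_set N) : x y / x * y} by move=> x y; apply: psiM.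
have psiL x : (f \o lcoset_set N) x \in L2 F.
  by apply: (fintype.subsetP HL); apply: psiH.
case: (Gamma_kernel_cases psiM' psiL) => e.
- by case: nT; apply/seteqP; split=> // x _; apply/kerN.
- by left; apply/seteqP; split=> x; [move=> /kerN-/(_ I)/e|move=> /e/kerN; apply].
- by right; apply/seteqP; split=> x; [move=> /kerN-/(_ I)/e|move=> /e/kerN; apply].
Qed.

Lemma sqr_Delta x : Delta (x * x).
Proof.
have [w ->] := Gamma_word x; rewrite -big_cat; apply/Delta_word.
by rewrite size_cat addnn odd_double.
Qed.

Lemma quot_in_L2_N0 : quot_in_some_L2 N0.
Proof.
exists 'F_11, (SL2_group 'F_11 / pmI 'F_11)%G; split; last by have [] := normal_N0.
  by rewrite card_Fp.
by [].
Qed.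

Lemma quot_in_L2_Delta : quot_in_some_L2 Delta.
Proof.
have [e eL [ne ee]] := L2_involution 'F_11.
exists 'F_11, <[e]>%G; split; first by rewrite card_Fp.
  by rewrite cycle_subG.
pose psi (x : Gamma) := if parity x == 1 then 1 else e.
have psiw w : psi (\prod_(i <- w) gamma i) = if odd (size w) then e else 1.
  have := Delta_word w; rewrite /psi /Delta /=.
  by case: eqP; case: odd => // P [] // Q R; [case: (Q P)|case: P; apply: R].
have epow n : e ^+ n = if odd n then e else 1.
  by elim: n => // n IHn; rewrite expgS IHn /=; case: odd; rewrite /= ?mulg1.
have [|nD [f isof _]] :=
  @iso_of_quotient_map _ _ setT Delta <[e]> psi (subgroupT _) (fun _ _ => I);
  last by exists f.
split=> [x y _ _|x _|y /cycleP[n ->]|x _].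
- have [v ->] := Gamma_word x; have [w ->] := Gamma_word y.
  rewrite -big_cat !psiw size_cat oddD.
  by case: odd; case: odd; rewrite /= ?mulg1 ?mul1g.
- by rewrite /psi; case: ifP => _; [apply: group1|apply: cycle_id].
- exists (\prod_(i <- nseq n gen_a) gamma i) => //.
  by rewrite psiw size_nseq epow.
- rewrite /psi /Delta /=; case: eqP => [->|np]; first by split.
  by split.
Qed.

Lemma phi_parity_map :
  quotient_map setT K0 (finset.setX (L2 'F_11) C2) (fun x => (phi x, parity x)).
Proof.
split=> [x y _ _|x _|[y z]|x _].
- by rewrite phiM parityM.
- by rewrite finset.in_setX phi_L2 inE.
- rewrite finset.in_setX => /andP[/phi_onto[x Dx <-] _].
  have [->|nz] := eqVneq z 1; first by exists x => //; rewrite Dx.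
  have -> : z = 1%R.
    by case: z nz => [[|[|//]] ltz] // _; apply: val_inj.
  (* An odd preimage of phi x: an element of Delta over phi (x a), times a. *)
  have [x' Dx' e] := phi_onto (phi_L2 (x * gamma gen_a)).
  exists (x' * gamma gen_a) => //; congr (_, _).
    by rewrite phiM e -phiM -mulgA gamma_sqr mulg1.
  by rewrite parityM parity_gen Dx' mul1g.
- by split=> [[e1 e2]|[Dx Nx]]; [split|congr (_, _)].
Qed.

Lemma is_N0_N0 : is_N0 K0 N0.
Proof.
have [nK [f isof fE]] :=
  iso_of_quotient_map (subgroupT _) (fun _ _ => I) phi_parity_map.
have [_ _ onto _] := phi_parity_map.
split=> //; [by case: normal_N0|by move=> x []|].
exists f; split=> //; apply/seteqP; split.
  move=> _ [_ [x Nx <-] <-]; rewrite fE //= finset.in_setX !inE andbT.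
  exact/eqP.
move=> [y z] /=; rewrite finset.in_setX !inE andbT => /eqP->.
have [|x _ [e1 e2]] := onto (1, z).
  by rewrite finset.in_setX inE andbT; apply: group1.
by exists (lcoset_set K0 x); [exists x|rewrite fE // e1 e2].
Qed.

(** N is the kernel of the first component of the isomorphism, and not Delta because
the squares of elements of Gamma lie in Delta while L_2(11) has elements with y^2 <> 1. *)
Lemma is_N0_unique N : is_N0 K0 N -> N0 = N.
Proof.
move=> [nK nN KN [f [isof fim]]]; have [[_ finj _] _] := isof.
have [psiM psiA onto kerK] := quotient_map_of_iso nK isof.
have [[sK _ _ _] [sN _ _ _]] := (nK, nN).
pose psi x := (f (lcoset_set K0 x)).1.
have psi_M : {morph psi : x y / x * y}.
  by move=> x y; rewrite /psi [f _](psiM x y).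
have psiL x : psi x \in L2 'F_11.
  have := psiA x I; rewrite /psi /=; case: (f _) => u v.
  by rewrite finset.in_setX => /andP[].
have psi_onto y : y \in L2 'F_11 -> exists x, psi x = y.
  move=> yL; have [|x _ e] := onto (y, 1).
    by rewrite finset.in_setX yL inE.
  by exists x; rewrite /psi [f _]e.
have ker x : psi x = 1 <-> N x.
  split=> [p1|Nx].
    have : [set` finset.setX [1 coset_of (pmI 'F_11)] C2] (f (lcoset_set K0 x)).
      by rewrite /= [f _]surjective_pairing finset.in_setX !inE andbT; apply/eqP.
    rewrite -fim => -[_ [n Nn <-]] /finj e.
    have Knx : K0 (n^-1 * x).
      by apply/lcoset_set_eq => //; apply: e; rewrite inE; [exists n|exists x].
    by rewrite -(mulKVg n x); apply: subgroupM => //; apply: KN.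
  have : (f @` coset_set K0 N) (f (lcoset_set K0 x)).
    by exists (lcoset_set K0 x) => //; exists x.
  rewrite fim /= [f _]surjective_pairing finset.in_setX !inE andbT.
  by move/eqP.
have [y yL [y1 y2]] := L2_11_large_order.
have [x ex] := psi_onto y yL.
case: (Gamma_kernel_cases psi_M psiL) => e.
- by case: y1; rewrite -ex e.
- by case: y2; rewrite -ex -psi_M; apply/e/sqr_Delta.
- by apply/seteqP; split=> z; [move/e/ker|move/ker/e].
Qed.
End Final.

Local Open Scope classical_set_scope.

Theorem corollary1p5 :
  exists K0 N0 : set Gamma,
    [/\ unique is_K0 K0,
        unique (is_N0 K0) N0,
        forall N : set Gamma,
          [/\ normal_in N setT, N <> setT & quot_in_some_L2 N] <->
          (N = Delta \/ N = N0),
        quot_isog setT Delta C2 &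
        quot_isog setT N0 (L2 'F_11)].
Proof.
exists K0, N0; split.
- by split; [exact: is_K0_K0|exact: is_K0_unique].
- by split; [exact: is_N0_N0|exact: is_N0_unique].
- move=> N; split=> [[]|[]->]; first exact: quotient_kernel.
  + split; [by case: normal_Delta| |exact: quot_in_L2_Delta].
    move=> DT; have [+ _] := Delta_word [:: gen_a].
    by rewrite DT => /(_ I).
  + split; [by case: normal_N0| |exact: quot_in_L2_N0].
    by move=> NT; have [x _ nx] := phi_neq1; apply: nx; rewrite -[_ = _]/(N0 x) NT.
- by case: normal_Delta.
- by case: normal_N0.
Qed.
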